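(* Let $P\colon C\to C$ be a map satisfying all the standing assumptions listed in the context, and let $S$ be its carrying simplex. If $S$ is convex (that is, the set $\Gamma=\{\alpha x:\alpha\in[0,1],\ x\in S\}$ is convex), then $S$ is a $C^1$ submanifold-with-corners neatly embedded in $C$, diffeomorphic to the standard probability simplex $\triangle$ via radial projection.
   Context: Notation. $H=\mathbb{R}^3$ is the affine space of points, $V=\mathbb{R}^3$ the vector space of vectors, with Euclidean norm and standard basis $e_1,e_2,e_3$. $C=\{x\in H: x_i\ge 0,\ i=1,2,3\}$, $C^\circ=\{x\in H: x_i>0,\ i=1,2,3\}$, $\partial C=C\setminus C^\circ$. For nonempty $I\subset\{1,2,3\}$ put $\overline I=\{1,2,3\}\setminus I$, $H_I=\{x\in H: x_j=0 \text{ for } j\in\overline I\}$, $V_I=\{v\in V: v_j=0\text{ for }j\in\overline I\}$ (also $V_\emptyset=\{0\}$), $H_I^+=C\cap H_I$, $\dot H_I^+=\{x\in H_I^+: x_i>0\text{ for }i\in I\}$, $\partial H_I^+=H_I^+\setminus\dot H_I^+$. For $x,y\in H_I$: $x\ll_I y$ means $x_i<y_i$ for all $i\in I$; $x\le_I y$ means $x_i\le y_i$ for all $i\in I$; $x<_I y$ means $x\le_I y$, $x\ne y$; the subscript is dropped for $I=\{1,2,3\}$. $K=\{v\in V: v_i\ge0,\ i=1,2,3\}$, $K_I=K\cap V_I$. For a matrix $M$, $M_I$ is its $I\times I$ submatrix. $\triangle=\{x\in C: x_1+x_2+x_3=1\}$, and the radial projection is $R(x)=x/(x_1+x_2+x_3)$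 for $x\in C\setminus\{0\}$. Standing assumptions on $P=(P_1,P_2,P_3)\colon C\to H$: (H1) $P$ is a $C^2$ diffeomorphism onto its image $P(C)$, i.e. there are an open $U\subset H$ with $C\subset U$ and a $C^2$ diffeomorphism $\tilde P\colon U\to\tilde P(U)$ with $\tilde P|_C=P$. (H2) For each nonempty $I\subset\{1,2,3\}$, each of the sets $A=H_I^+$, $\dot H_I^+$, $\partial H_I^+$ satisfies $P(A)\subset A$ and $P^{-1}(A)\subset A$. (H3') For each nonempty $I\subset\{1,2,3\}$ and $x\in\dot H_I^+$, the $I\times I$ matrix $D(P|_{H_I^+})(x)^{-1}=(DP(x)^{-1})_I$ has all entries positive. Moreover, for any $v\in K_{\overline I}\setminus\{0\}$ there is some $j\in I$ with $(DP(x)^{-1}v)_j>0$. (H4') For each $i$, $P|_{H^+_{\{i\}}}$ has a unique fixed point $u_i>0$ (i.e. with positive $i$-th coordinate), and $0<\frac{d}{dx_i}(P|_{H^+_{\{i\}}})(u_i)<1$. Moreover $\frac{\partial P_i}{\partial x_j}(u_i)<0$ for $j\ne i$. (H5) If $x\neq0$ is a $p$-periodic point of $P$ and $x\in\dot H_I^+$, then $\mu_{I,p}(x)<1$, where $\mu_{I,p}(x)$ is the (necessarily real) eigenvalue of $D(P|_{H_I^+})^p(x)$ with the smallest modulus. (H6) For each nonempty $I\subset\{1,2,3\}$ and $x,y\in\dot H_I^+$, if $0\ll_I Px\ll_I Py$, then $\frac{P_ix}{P_iy}\ge\frac{x_i}{y_i}$ for all $i\in I$. Carrying simplex. It is known that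 under these assumptions there is a compact invariant set $S\subset C$ ($P(S)=S$), called the carrying simplex of $P$, such that: (i) $R|_S\colon S\to\triangle$ is a homeomorphism; (ii) no two points of $S$ are related by $\ll$, and no two points of $S\cap C^\circ$ are related by $<$; (iii) $\omega(x)\subset S$ for all $x\in C\setminus\{0\}$, where $\omega(x)$ is the set of limits of subsequences of $(P^nx)_n$; (iv) $\Gamma=\{\alpha x:\alpha\in[0,1],x\in S\}$ is the global attractor of $P$ (a compact invariant set such that for each bounded $B\subset C$ and $\epsilon>0$ there is $n_0$ with $P^n(B)$ contained in the $\epsilon$-neighbourhood of $\Gamma$ for all $n\ge n_0$). Put $\partial S=S\cap\partial C$ and $\dot S_I=S\cap\dot H_I^+$. Meaning of the conclusion. ''$S$ is a $C^1$ submanifold-with-corners diffeomorphic to $\triangle$ via radial projection'' means that $(R|_S)^{-1}(y)=\rho(y)\,y$ for $y\in\triangle$, where $\rho\colon\triangle\to(0,\infty)$ is $C^1$ in the sense that there are an open neighbourhood $\tilde U$ of $\triangle$ in the plane $\{x: x_1+x_2+x_3=1\}$ and a $C^1$ function $\tilde\rho\colon\tilde U\to(0,\infty)$ with $\tilde\rho|_\triangle=\rho$. The tangent space $\mathcal T_xS$ at $x\in S$ is the image of $\{v\in V: v_1+v_2+v_3=0\}$ under the derivative of $y\mapsto\tilde\rho(y)y$ at $y=R(x)$. ''$S$ is neatly embedded in $C$'' means that for every $x\in\partial S$, with $I$ such that $x\in\dot S_I$, one has $\mathcal T_xS+V_I=V$. *)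

(* Defs.v *)
From mathcomp Require Import all_boot all_order all_algebra.
From mathcomp Require Import all_classical all_reals all_analysis.
From mathcomp Require Import complex.

Set Implicit Arguments.
Unset Strict Implicit.
Unset Printing Implicit Defensive.

Import Order.TTheory GRing.Theory Num.Theory.
Import numFieldNormedType.Exports.

Local Open Scope classical_set_scope.
Local Open Scope ring_scope.

(** Points of H and vectors of V are row vectors ['rV[R]_3]; the coordinates are
    indexed by ['I_3 = {0, 1, 2}] instead of {1, 2, 3}. *)

(** * Differential calculus *)

(** C^k on an open set [U] of a finite-dimensional space: in finite dimension,
    continuity of the derivative [x |-> 'd f x] amounts to continuity of
    [x |-> 'D_v f x] for every fixed [v]. *)
Fixpoint Ck_on (R : realType) (V W : normedModType R) (k : nat) (U : set V)
    (f : V -> W) : Prop :=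
  if k is k'.+1 then
    (forall x, U x -> differentiable f x) /\
    (forall v, Ck_on k' U (fun x => 'D_v f x))
  else forall x, U x -> {for x, continuous f}.

(** [f] restricts to a C^k diffeomorphism from the open set [U] onto the open
    set [f @` U]. *)
Definition Ck_diffeo (R : realType) (V W : normedModType R) (k : nat)
    (U : set V) (f : V -> W) : Prop :=
  [/\ open U, open (f @` U), Ck_on k U f &
      exists g : W -> V, Ck_on k (f @` U) g /\ forall x, U x -> g (f x) = x].

(** Derivative matrix in the column convention, [D f x i j] being the partial
    derivative of [f_i] in [x_j]; the library's Jacobian is its transpose. *)
Definition D (R : realType) (f : 'rV[R]_3 -> 'rV[R]_3) (x : 'rV[R]_3) : 'M[R]_3 :=
  ('J f x)^T.

Definition homeo_on (T1 T2 : topologicalType) (A : set T1) (B : set T2)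
    (f : T1 -> T2) : Prop :=
  [/\ set_bij A B f, {within A, continuous f} &
      exists g : T2 -> T1,
        {within B, continuous g} /\ forall x, A x -> g (f x) = x].

(** * Linear algebra *)

Definition enorm (R : realType) (v : 'rV[R]_3) : R :=
  Num.sqrt (\sum_i (v 0 i) ^+ 2).

Definition subM (R : realType) (I : {set 'I_3}) (M : 'M[R]_3) : 'M[R]_#|I| :=
  mxsub (@enum_val _ (mem I)) (@enum_val _ (mem I)) M.

(** [mu] is a real number which has the smallest modulus among all the complex
    eigenvalues of [M]. *)
Definition min_modulus_eigenvalue (R : realType) (n : nat) (M : 'M[R]_n) (mu : R) :
    Prop :=
  let MC : 'M[R[i]]_n := map_mx (real_complex R) M in
  eigenvalue MC (real_complex R mu) /\
  forall z : R[i], eigenvalue MC z -> `|real_complex R mu| <= `|z|.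

(** * Orthants, faces, orders *)

Definition orthant (R : realType) : set 'rV[R]_3 :=
  [set x | forall i, 0 <= x 0 i].
Arguments orthant : clear implicits.

Definition int_orthant (R : realType) : set 'rV[R]_3 :=
  [set x | forall i, 0 < x 0 i].
Arguments int_orthant : clear implicits.

Definition bd_orthant (R : realType) : set 'rV[R]_3 :=
  orthant R `\` int_orthant R.
Arguments bd_orthant : clear implicits.

(** Both H_I and V_I. *)
Definition coordsub (R : realType) (I : {set 'I_3}) : set 'rV[R]_3 :=
  [set x | forall j, j \notin I -> x 0 j = 0].
Arguments coordsub : clear implicits.

(** Both H_I^+ and K_I. *)
Definition face (R : realType) (I : {set 'I_3}) : set 'rV[R]_3 :=
  orthant R `&` coordsub R I.
Arguments face : clear implicits.

Definition int_face (R : realType) (I : {set 'I_3}) : set 'rV[R]_3 :=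
  [set x | face R I x /\ forall i, i \in I -> 0 < x 0 i].
Arguments int_face : clear implicits.

Definition bd_face (R : realType) (I : {set 'I_3}) : set 'rV[R]_3 :=
  face R I `\` int_face R I.
Arguments bd_face : clear implicits.

Definition llI (R : realType) (I : {set 'I_3}) (x y : 'rV[R]_3) : Prop :=
  forall i, i \in I -> x 0 i < y 0 i.

Definition leI (R : realType) (I : {set 'I_3}) (x y : 'rV[R]_3) : Prop :=
  forall i, i \in I -> x 0 i <= y 0 i.

Definition ltI (R : realType) (I : {set 'I_3}) (x y : 'rV[R]_3) : Prop :=
  leI I x y /\ x <> y.

(** The plane containing the standard simplex, and its direction. *)
Definition plane (R : realType) : set 'rV[R]_3 :=
  [set x | \sum_i x 0 i = 1].
Arguments plane : clear implicits.

Definition plane_dir (R : realType) : set 'rV[R]_3 :=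
  [set v | \sum_i v 0 i = 0].
Arguments plane_dir : clear implicits.

Definition simplex (R : realType) : set 'rV[R]_3 := orthant R `&` plane R.
Arguments simplex : clear implicits.

Definition radial (R : realType) (x : 'rV[R]_3) : 'rV[R]_3 :=
  (\sum_i x 0 i)^-1 *: x.

(** * Standing assumptions on P

    [P] is only meaningful on [orthant R]. [Pt] is a C^2 extension of [P] to an
    open neighbourhood of it, used to express the derivatives of [P] and of its
    iterates at points of [orthant R]; these do not depend on the choice of the
    extension, because [orthant R] is the closure of its interior. *)

Definition H1 (R : realType) (P Pt : 'rV[R]_3 -> 'rV[R]_3) (U : set 'rV[R]_3) :
    Prop :=
  [/\ orthant R `<=` U, Ck_diffeo 2 U Pt &
      forall x, orthant R x -> Pt x = P x].

Definition H2 (R : realType) (P : 'rV[R]_3 -> 'rV[R]_3) : Prop :=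
  forall I : {set 'I_3}, I != finset.set0 ->
  forall A : set 'rV[R]_3, A = face R I \/ A = int_face R I \/ A = bd_face R I ->
    P @` A `<=` A /\ orthant R `&` P @^-1` A `<=` A.

Definition H3' (R : realType) (Pt : 'rV[R]_3 -> 'rV[R]_3) : Prop :=
  forall I : {set 'I_3}, I != finset.set0 ->
  forall x, int_face R I x ->
    (forall i j, 0 < subM I (invmx (D Pt x)) i j) /\
    (forall v, face R (~: I)%SET v -> v <> 0 ->
       exists2 j, j \in I & 0 < (invmx (D Pt x) *m v^T) j 0).

Definition H4' (R : realType) (P Pt : 'rV[R]_3 -> 'rV[R]_3) : Prop :=
  forall i : 'I_3, exists u : 'rV[R]_3,
    [/\ int_face R [set i]%SET u /\ P u = u,
        forall y, int_face R [set i]%SET y -> P y = y -> y = u,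
        0 < D Pt u i i < 1 &
        forall j, j != i -> D Pt u i j < 0].

(** The period [p] need not be minimal. The eigenvalue of smallest modulus is
    unique and real by Perron's theorem, [(D (iter p Pt) x)^-1] having a positive
    [I x I] block by [H3']. *)
Definition H5 (R : realType) (P Pt : 'rV[R]_3 -> 'rV[R]_3) : Prop :=
  forall (p : nat) (I : {set 'I_3}) (x : 'rV[R]_3),
    (0 < p)%N -> I != finset.set0 -> x <> 0 -> int_face R I x ->
    iter p P x = x ->
    exists mu : R,
      min_modulus_eigenvalue (subM I (D (iter p Pt) x)) mu /\ mu < 1.

Definition H6 (R : realType) (P : 'rV[R]_3 -> 'rV[R]_3) : Prop :=
  forall I : {set 'I_3}, I != finset.set0 ->
  forall x y, int_face R I x -> int_face R I y ->
    llI I 0 (P x) -> llI I (P x) (P y) ->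
    forall i, i \in I -> x 0 i / y 0 i <= P x 0 i / P y 0 i.

(** * The carrying simplex *)

Definition omega_limit (R : realType) (P : 'rV[R]_3 -> 'rV[R]_3) (x : 'rV[R]_3) :
    set 'rV[R]_3 :=
  [set y | exists phi : nat -> nat,
     {homo phi : m n / (m < n)%N} /\ iter (phi n) P x @[n --> \oo] --> y].

(** The union of the segments joining the origin to the points of [S]. *)
Definition cone_hull (R : realType) (S : set 'rV[R]_3) : set 'rV[R]_3 :=
  [set z | exists a x, [/\ 0 <= a <= 1, S x & z = a *: x]].

Definition global_attractor (R : realType) (P : 'rV[R]_3 -> 'rV[R]_3)
    (G : set 'rV[R]_3) : Prop :=
  [/\ compact G, P @` G = G &
      forall B : set 'rV[R]_3, B `<=` orthant R -> bounded_set B ->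
      forall e : R, 0 < e ->
      exists n0 : nat, forall n, (n0 <= n)%N -> forall x, B x ->
        exists2 y, G y & enorm (iter n P x - y) < e].

Definition carrying_simplex (R : realType) (P : 'rV[R]_3 -> 'rV[R]_3)
    (S : set 'rV[R]_3) : Prop :=
  [/\ [/\ S `<=` orthant R, compact S & P @` S = S],
      homeo_on S (simplex R) (@radial R),
      (forall x y, S x -> S y -> ~ llI [set: 'I_3]%SET x y) /\
      (forall x y, (S `&` int_orthant R) x -> (S `&` int_orthant R) y ->
         ~ ltI [set: 'I_3]%SET x y),
      (forall x, orthant R x -> x <> 0 -> omega_limit P x `<=` S) &
      global_attractor P (cone_hull S)].

Definition convex_carrying_simplex (R : realType) (S : set 'rV[R]_3) : Prop :=
  convex_set (cone_hull S : set (convex_lmodType 'rV[R]_3)).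

(** * Smoothness of S *)

(** An affine chart of [plane R]. *)
Definition chart (R : realType) (a : 'rV[R]_2) : 'rV[R]_3 :=
  row_mx a (1 - \sum_i a 0 i)%:M.

(** [rho] is positive and C^1 on the neighbourhood [O `&` plane R] of the simplex
    in the plane, where [O] is open in the space; its values off the plane are
    irrelevant. *)
Definition C1_radial_param (R : realType) (S O : set 'rV[R]_3)
    (rho : 'rV[R]_3 -> R) : Prop :=
  [/\ open O, simplex R `<=` O,
      forall y, (O `&` plane R) y -> 0 < rho y,
      Ck_on 1 (@chart R @^-1` O) (rho \o @chart R : 'rV[R]_2 -> R^o) &
      forall y, simplex R y -> S (rho y *: y) /\ radial (rho y *: y) = y].

(** Directional derivatives along [plane_dir R] at a point of [plane R] only
    involve the values on that plane. *)
Definition tangent (R : realType) (rho : 'rV[R]_3 -> R) (x : 'rV[R]_3) :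
    set 'rV[R]_3 :=
  [set 'D_v (fun y => rho y *: y) (radial x) | v in plane_dir R].

Definition neatly_embedded (R : realType) (S : set 'rV[R]_3)
    (rho : 'rV[R]_3 -> R) : Prop :=
  forall (x : 'rV[R]_3) (I : {set 'I_3}),
    (S `&` bd_orthant R) x -> I != finset.set0 -> (S `&` int_face R I) x ->
    [set t + v | t in tangent rho x & v in coordsub R I] = setT.

(* Main.v *)
From HB Require Import structures.
Require Import Defs.
From mathcomp Require Import all_boot all_order all_algebra.
From mathcomp Require Import all_classical all_reals all_analysis.
From mathcomp Require Import ring lra.

(** Call a covector [p] normal at a point [x] of [S] if [p] attains at [x] its
    maximum over the convex set [Gamma]. At interior points of [S] the normals
    are nonnegative, because no two points of [S] are related by [<], and they
    are pulled back by the derivative of [P], because [P] maps [Gamma] onto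
    itself. The closure [L] of the normal bundle over the interior of [S],
    normalized by [p . x = 1], is compact, and every [(x, p)] in [L] satisfies
    [p = s q (DP y)^-1] with [P y = x], [s > 0] and [(y, q)] in [L].

    By (H3') the matrices [(DP y)^-1], [y] in [S], are nonnegative and any two of
    their columns have a common positive row; in particular the covectors of [L]
    have positive entries. Hence if [p] and [q] are two normals of [L] over the
    same point whose cross-ratio [p_j q_l / (q_j p_l)] is maximal among all such
    pairs, a value greater than 1 would be exceeded by the pair from which they
    come. So there is exactly one normal [nu x] of [L] over each [x], depending
    continuously on [x].

    The gauge of [Gamma] at [z] is [nu x . z], where [x] is the point of [S] on the
    ray of [z], and it dominates [nu x' . z] for all other [x']; comparing both
    bounds shows that [nu] is its gradient on the closed orthant. Reflections in
    the coordinate planes extend the gauge to a C^1 function near the simplex,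
    whose inverse is the radial parametrization. Neatness holds because
    [x] itself belongs to [V_I] and is transversal to every radial graph. *)

Set Implicit Arguments.
Unset Strict Implicit.
Unset Printing Implicit Defensive.

Import Order.TTheory GRing.Theory Num.Theory.
Import numFieldNormedType.Exports.

Local Open Scope classical_set_scope.
Local Open Scope ring_scope.

(** * Differentiability from first-order estimates, and the dot product of row vectors *)

Lemma differentiable_linear (R : realType) (V W : normedModType R) (f : V -> W)
    (L : {linear V -> W}) (x : V) :
  continuous L ->
  (forall e : R, 0 < e -> exists2 d : R, 0 < d &
     forall y : V, `|y - x| < d -> `|f y - f x - L (y - x)| <= e * `|y - x|) ->
  differentiable f x /\ 'd f x = L :> (V -> W).
Proof.
move=> Lc fL.
have fo : f \o shift x = cst (f x) + L +o_ 0 id.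
  apply/eqaddoP => _/posnumP[e].
  have [//|d d0 fd] := fL e%:num.
  apply/nbhs_ballP; exists d => //= y.
  rewrite -ball_normE /= sub0r normrN => yd.
  have := fd (y + x); rewrite addrK => /(_ yd).
  by congr (`|_| <= _); rewrite /= opprD addrA.
have df : 'd f x = L :> (V -> W) by exact: diff_unique.
by split=> //; apply/diff_locallyP; rewrite df.
Qed.

Section DotProduct.
Variables (R : realType) (n : nat).
Implicit Types (u v w : 'rV[R]_n) (a e : R).

Definition dot u v : R := \sum_i u 0 i * v 0 i.

Lemma dotC u v : dot u v = dot v u.
Proof. by apply: eq_bigr => i _; rewrite mulrC. Qed.

Lemma dotDr u v w : dot u (v + w) = dot u v + dot u w.
Proof. by rewrite -big_split; apply: eq_bigr => i _; rewrite mxE mulrDr. Qed.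

Lemma dotZr a u v : dot u (a *: v) = a * dot u v.
Proof. by rewrite mulr_sumr; apply: eq_bigr => i _; rewrite mxE mulrCA. Qed.

Lemma dotNr u v : dot u (- v) = - dot u v.
Proof. by rewrite -scaleN1r dotZr mulN1r. Qed.

Lemma dotBr u v w : dot u (v - w) = dot u v - dot u w.
Proof. by rewrite dotDr dotNr. Qed.

Lemma dot0r u : dot u 0 = 0.
Proof. by rewrite -(scale0r 0) dotZr mul0r. Qed.

Lemma dotZl a u v : dot (a *: v) u = a * dot v u.
Proof. by rewrite !(dotC _ u) dotZr. Qed.

Lemma dotBl u v w : dot (v - w) u = dot v u - dot w u.
Proof. by rewrite !(dotC _ u) dotBr. Qed.

Lemma dot_delta u i : dot u (delta_mx 0 i) = u 0 i.
Proof.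
rewrite /dot (bigD1 i) //= mxE !eqxx mulr1 big1 ?addr0 // => j ji.
by rewrite mxE (negPf ji) andbF mulr0.
Qed.

Lemma coord_norm_le u i : `|u 0 i| <= `|u|.
Proof.
rewrite [leRHS]/Num.norm /= mx_normrE; apply/bigmax_geP; right => /=.
by exists (0, i).
Qed.

Lemma row_norm_le u a : 0 <= a -> (forall i, `|u 0 i| <= a) -> `|u| <= a.
Proof.
move=> a0 ua; rewrite [leLHS]/Num.norm /= mx_normrE; apply/bigmax_leP; split=> //.
by move=> [i j] _ /=; rewrite ord1.
Qed.

Lemma row_norm_lt u a : 0 < a -> (forall i, `|u 0 i| < a) -> `|u| < a.
Proof.
move=> a0 ua; rewrite [ltLHS]/Num.norm /= mx_normrE; apply/bigmax_ltP; split=> //.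
by move=> [i j] _ /=; rewrite ord1.
Qed.

Lemma norm_dot_le u v : `|dot u v| <= n%:R * `|u| * `|v|.
Proof.
apply: le_trans (ler_norm_sum _ _ _) _.
have -> : n%:R * `|u| * `|v| = \sum_(i < n) `|u| * `|v|.
  by rewrite sumr_const card_ord -mulrA mulr_natl.
apply: ler_sum => i _.
by rewrite normrM ler_pM// coord_norm_le.
Qed.

Lemma cvg_coord (T : Type) (F : set_system T) (f : T -> 'rV[R]_n) u i :
  Filter F -> f @ F --> u -> f y 0 i @[y --> F] --> u 0 i.
Proof. by move=> FF fu; exact: (cvg_comp _ _ fu (@coord_continuous _ _ _ 0 i u)). Qed.

Lemma cvg_row (T : Type) (F : set_system T) (f : T -> 'rV[R]_n) u :
  Filter F -> (forall i, f y 0 i @[y --> F] --> u 0 i) -> f @ F --> u.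
Proof.
move=> FF fu; apply/cvgrPdist_lt => e e0.
have : \forall y \near F, forall i, `|u 0 i - f y 0 i| < e.
  by apply: filter_forall => i; move/cvgrPdist_lt: (fu i); apply.
by apply: filterS => y fy; apply: row_norm_lt => // i; rewrite !mxE.
Qed.

Lemma cvg_dot (T : Type) (F : set_system T) (f g : T -> 'rV[R]_n) u v :
  Filter F -> f @ F --> u -> g @ F --> v ->
  dot (f y) (g y) @[y --> F] --> dot u v.
Proof.
move=> FF fu gv; apply: cvg_big => [|i _].
  exact: add_continuous.
by apply: cvgM; exact: cvg_coord.
Qed.

Lemma differentiable_dot (f : 'rV[R]_n -> R^o) (x : 'rV[R]_n) u :
  (forall e : R, 0 < e -> exists2 d : R, 0 < d &
     forall y : 'rV[R]_n, `|y - x| < d ->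
       `|f y - f x - dot u (y - x)| <= e * `|y - x|) ->
  differentiable f x /\ forall v, 'D_v f x = dot u v.
Proof.
move=> fu.
have dlin : linear (dot u : 'rV[R]_n -> R^o).
  by move=> a v w; rewrite dotDr dotZr.
pose dM := GRing.isLinear.Build _ _ _ _ _ dlin.
pose dL : {linear 'rV[R]_n -> R^o} := HB.pack (dot u : 'rV[R]_n -> R^o) dM.
have [fd df] : differentiable f x /\ 'd f x = dL :> ('rV[R]_n -> R^o).
  apply: differentiable_linear => // y.
  by apply: (@cvg_dot _ (nbhs y) (cst u) id); [exact: cvg_cst|].
by split=> // v; rewrite deriveE// df.
Qed.

End DotProduct.

(** * Extension of C^1 functions across coordinate hyperplanes *)

Section ReflectionExtension.
Variables (R : realType) (n : nat).
Implicit Types (A B : set 'rV[R]_n) (f : 'rV[R]_n -> R)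
  (g : 'rV[R]_n -> 'rV[R]_n) (x y : 'rV[R]_n) (i : 'I_n).

(** [A] need not have interior points: [g] is a gradient of [f] relative to [A]. *)
Definition C1_within A f g := forall x, A x -> forall e : R, 0 < e ->
  exists2 d : R, 0 < d & forall y, A y -> `|y - x| < d ->
    `|g y - g x| <= e /\ `|f y - f x - dot (g x) (y - x)| <= e * `|y - x|.

Definition pos_coord i x : 'rV[R]_n :=
  \row_j if j == i then Num.max (x 0 j) 0 else x 0 j.

Definition abs_coord i x : 'rV[R]_n := \row_j if j == i then `|x 0 j| else x 0 j.

Lemma pos_coord_ge0 i x : 0 <= x 0 i -> pos_coord i x = x.
Proof.
move=> xi; apply/rowP => j; rewrite mxE; case: eqP => // ->.
by apply/max_idPl.
Qed.

Lemma abs_coord_ge0 i x : 0 <= x 0 i -> abs_coord i x = x.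
Proof.
by move=> xi; apply/rowP => j; rewrite mxE; case: eqP => // ->; rewrite ger0_norm.
Qed.

Lemma pos_coord_lip i x y : `|pos_coord i y - pos_coord i x| <= `|y - x|.
Proof.
apply: row_norm_le => // j; rewrite !mxE.
have := coord_norm_le (y - x) j; rewrite !mxE.
have [_|//] := eqVneq j i; apply: le_trans.
have := ler_norm (y 0 j - x 0 j); have := ler_norm (x 0 j - y 0 j).
rewrite (distrC (x 0 j)) ler_norml.
by case: (leP (x 0 j) 0); case: (leP (y 0 j) 0) => ? ? ? ?; lra.
Qed.

Lemma abs_coord_lip i x y : `|abs_coord i y - abs_coord i x| <= `|y - x|.
Proof.
apply: row_norm_le => // j; rewrite !mxE.
have := coord_norm_le (y - x) j; rewrite !mxE.
by have [_|//] := eqVneq j i; exact/le_trans/ler_dist_dist.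
Qed.

(** For [x_i < 0] this is twice the value at the foot on the hyperplane minus the value at the
    mirror image. Unlike the even reflection, it keeps the derivative in direction [i] continuous
    across the hyperplane. *)
Definition reflect_ext i f x : R := 2 * f (pos_coord i x) - f (abs_coord i x).

Definition reflect_grad i g x : 'rV[R]_n :=
  \row_j if j == i then g (abs_coord i x) 0 j
         else 2 * g (pos_coord i x) 0 j - g (abs_coord i x) 0 j.

Lemma reflect_ext_ge0 i f x : 0 <= x 0 i -> reflect_ext i f x = f x.
Proof. by move=> xi; rewrite /reflect_ext pos_coord_ge0// abs_coord_ge0//; lra. Qed.

(** In coordinate [i]: if [x_i >= 0], both images of [x] are [x] itself and [2 max(t, 0) - |t| = t]
    applies to [y_i]. If [x_i] and [y_i] are negative, the positive parts cancel and the absolute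
    value only changes a sign. The identity breaks down for [x_i < 0 <= y_i], which the hypothesis
    excludes. *)
Lemma dot_reflect_grad i g x y : (x 0 i < 0 -> y 0 i < 0) ->
  dot (reflect_grad i g x) (y - x) =
  2 * dot (g (pos_coord i x)) (pos_coord i y - pos_coord i x)
  - dot (g (abs_coord i x)) (abs_coord i y - abs_coord i x).
Proof.
move=> xy; rewrite /dot mulr_sumr -sumrB; apply: eq_bigr => j _.
rewrite !mxE; have [->|_] := eqVneq j i; last by ring.
have [x0|x0] := ltP (x 0 i) 0.
  have y0 := xy x0; rewrite !ltr0_norm//.
  by case: (leP (x 0 i) 0); case: (leP (y 0 i) 0) => ? ?; lra.
rewrite pos_coord_ge0// abs_coord_ge0// (ger0_norm x0).
have [y0|y0] := leP (y 0 i) 0.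
  by rewrite ler0_norm//; case: (leP (x 0 i) 0) => ?; nra.
by rewrite gtr0_norm//; case: (leP (x 0 i) 0) => ?; nra.
Qed.

Lemma C1_within_reflect A B i f g :
  (forall x, B x -> A (pos_coord i x) /\ A (abs_coord i x)) ->
  C1_within A f g -> C1_within B (reflect_ext i f) (reflect_grad i g).
Proof.
move=> BA fg x Bx e e0; have [Apx Arx] := BA _ Bx.
(* The two errors enter with weights 2 and 1, so any fraction of [e] up to a third would do. *)
have e4 : 0 < e / 4 by rewrite divr_gt0.
have [d1 d10 H1] := fg _ Apx _ e4; have [d2 d20 H2] := fg _ Arx _ e4.
pose d0 : R := if x 0 i < 0 then - x 0 i else 1.
have d00 : 0 < d0 by rewrite /d0; case: ifP => // x0; rewrite oppr_gt0.
exists (Num.min d0 (Num.min d1 d2)); first by rewrite !lt_min d00 d10.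
move=> y By; rewrite !lt_min => /and3P[yd0 yd1 yd2].
have [Apy Ary] := BA _ By.
have [gp fp] := H1 _ Apy (le_lt_trans (pos_coord_lip i x y) yd1).
have [gr fr] := H2 _ Ary (le_lt_trans (abs_coord_lip i x y) yd2).
split.
  apply: row_norm_le => [|j]; first exact: ltW.
  have := le_trans (coord_norm_le _ j) gr; have := le_trans (coord_norm_le _ j) gp.
  rewrite !mxE; have [_|_] := eqVneq j i; rewrite !ler_norml => /andP[? ?] /andP[? ?]; lra.
have xy : x 0 i < 0 -> y 0 i < 0.
  move=> x0; move: yd0; rewrite /d0 x0 => yd0.
  have := le_lt_trans (coord_norm_le _ i) yd0.
  rewrite !mxE ltr_norml => /andP[_]; lra.
rewrite dot_reflect_grad// /reflect_ext.
have fp' := le_trans fp (ler_wpM2l (ltW e4) (pos_coord_lip i x y)).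
have fr' := le_trans fr (ler_wpM2l (ltW e4) (abs_coord_lip i x y)).
move: fp' fr'; rewrite !ler_norml => /andP[? ?] /andP[? ?].
have := mulr_ge0 (ltW e0) (normr_ge0 (y - x)).
by move=> ?; apply/andP; split; lra.
Qed.

End ReflectionExtension.

Lemma C1_within_open (R : realType) n (A : set 'rV[R]_n) (f : 'rV[R]_n -> R^o)
    (g : 'rV[R]_n -> 'rV[R]_n) (x : 'rV[R]_n) :
  open A -> A x -> C1_within A f g ->
  [/\ differentiable f x, forall v, 'D_v f x = dot (g x) v & {for x, continuous g}].
Proof.
move=> oA Ax fg.
have [r /= r0 rA] : nbhs_ball x A by apply/nbhs_ballP; exact: open_nbhs_nbhs.
have Ar (y : 'rV[R]_n) : `|y - x| < r -> A y.
  by move=> yr; apply: rA; rewrite -ball_normE /= distrC.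
have [df Df] : differentiable f x /\ forall v, 'D_v f x = dot (g x) v.
  apply: differentiable_dot => e e0; have [d d0 fd] := fg _ Ax _ e0.
  exists (Num.min d r); first by rewrite lt_min d0.
  by move=> y; rewrite lt_min => /andP[yd /Ar Ay]; have [] := fd _ Ay yd.
split=> //; have xF := nbhs_filter x.
apply/(cvgrPdist_le (F := nbhs x) g (g x)) => e e0; have [d d0 fd] := fg _ Ax _ e0.
apply/nbhs_ballP; exists (Num.min d r); first by rewrite /= lt_min d0.
move=> y; rewrite -ball_normE /= distrC lt_min => /andP[yd /Ar Ay].
by rewrite distrC; have [] := fd _ Ay yd.
Qed.

(** The positive coordinate excludes the origin, and is preserved by the two
    coordinate maps above. *)
Definition partial_orthant (R : realType) n (J : {set 'I_n}) : set 'rV[R]_n :=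
  [set x | (forall j, j \in J -> 0 <= x 0 j) /\ exists j, 0 < x 0 j].

(** Induction on the number of sign constraints: each reflection frees one coordinate, since both
    coordinate maps send the enlarged domain into the previous one. *)
Lemma C1_within_partial_orthant (R : realType) n (J : {set 'I_n}) f
    (g : 'rV[R]_n -> 'rV[R]_n) :
  C1_within (partial_orthant J) f g ->
  exists f' g', C1_within (partial_orthant finset.set0) f' g' /\
    forall x : 'rV[R]_n, partial_orthant J x -> f' x = f x.
Proof.
elim: {J}#|J| {-2}J (erefl #|J|) f g => [|k IH] J Jk f g fg.
  by move/eqP: Jk; rewrite cards_eq0 => /eqP J0; rewrite -J0; exists f, g.
have /card_gt0P[i iJ] : (0 < #|J|)%N by rewrite Jk.
have Jk' : #|J :\ i| = k by have := cardsD1 i J; rewrite iJ Jk => -[].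
have [|f' [g' [fg' ff']]] := IH _ Jk' (reflect_ext i f) (reflect_grad i g).
  apply: C1_within_reflect fg => x [x0 [j xj]]; split; split.
  - move=> l lJ; rewrite mxE; case: eqP => [_|/eqP li]; first by rewrite le_max lexx orbT.
    by apply: x0; rewrite in_setD1 li.
  - by exists j; rewrite mxE; case: eqP => // _; rewrite lt_max xj.
  - move=> l lJ; rewrite mxE; case: eqP => [_|/eqP li] //.
    by apply: x0; rewrite in_setD1 li.
  - by exists j; rewrite mxE; case: eqP => // _; rewrite gtr0_norm.
exists f', g'; split=> // x [x0 xj]; rewrite ff'; first exact/reflect_ext_ge0/x0.
by split=> // l; rewrite in_setD1 => /andP[_ /x0].
Qed.

Lemma open_partial_orthant0 (R : realType) n :
  open (@partial_orthant R n finset.set0).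
Proof.
have -> : @partial_orthant R n finset.set0 =
    \bigcup_(j : 'I_n) [set x : 'rV[R]_n | 0 < x 0 j].
  apply/seteqP; split=> x.
    by move=> [_ [j xj]]; exists j.
  by move=> [j _ xj]; split; [move=> l; rewrite finset.in_set0|exists j].
apply: bigcup_open => j _.
have -> : [set x : 'rV[R]_n | 0 < x 0 j] =
    (fun x : 'rV[R]_n => x 0 j) @^-1` [set t | 0 < t] by [].
apply: open_comp; last exact: open_gt.
by move=> x _; exact: coord_continuous.
Qed.

(** Serves to pass closed conditions from normals at interior points to their limits, and signs from
    the open orthant to the closed one. *)
Lemma closure_closed_image (T T' : topologicalType) (A : set T) (B : set T')
    (f : T -> T') (x : T) :
  closure A x -> {for x, continuous f} -> closed B ->
  (forall y, A y -> B (f y)) -> B (f x).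
Proof.
move=> Ax fx cB AB; apply: cB => V /fx fV.
by have [y [/AB By Vy]] := Ax _ fV; exists (f y).
Qed.

(** * Normals of the convex hull and their limits *)

Section ConvexSurface.
Variables (R : realType) (P : 'rV[R]_3 -> 'rV[R]_3) (S : set 'rV[R]_3).
Hypotheses (hS : carrying_simplex P S) (hconv : convex_carrying_simplex S).
Implicit Types (x y z p : 'rV[R]_3).

Local Notation hull := (cone_hull S).

Definition normal p x := forall y, hull y -> dot p y <= dot p x.

Lemma surface_orthant : S `<=` orthant R.
Proof. by case: hS => -[]. Qed.

Lemma surface_compact : compact S.
Proof. by case: hS => -[]. Qed.

Lemma surface_homeo : homeo_on S (simplex R) (@radial R).
Proof. by case: hS. Qed.

Lemma surface_unordered x y : (S `&` int_orthant R) x ->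
  (S `&` int_orthant R) y -> ~ ltI [set: 'I_3]%SET x y.
Proof. by case: hS => _ _ [_ +] _ _; apply. Qed.

Lemma hull_compact : compact hull.
Proof. by case: hS => _ _ _ _ []. Qed.

Lemma simplex_radial z : orthant R z -> z != 0 ->
  [/\ 0 < \sum_i z 0 i, simplex R (radial z) & radial z = (\sum_i z 0 i)^-1 *: z].
Proof.
move=> z0 /rV0Pn[i zi].
have s0 : 0 < \sum_i z 0 i.
  rewrite (bigD1 i) //= ltr_wpDr//; first by apply: sumr_ge0.
  by rewrite lt_neqAle eq_sym zi z0.
split=> //; split=> [j|]; first by rewrite mxE mulr_ge0// invr_ge0 ltW.
rewrite /plane /=; under eq_bigr do rewrite mxE.
by rewrite -mulr_sumr mulVf// gt_eqF.
Qed.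

Lemma surface_neq0 x : S x -> x != 0.
Proof.
move=> Sx; have [[/(_ _ Sx) sx _ _] _ _] := surface_homeo.
case: sx => _; rewrite /plane /= => s1; apply/eqP => x0; move/eqP: s1.
rewrite x0 /radial scaler0 big1 => [|i _]; last by rewrite mxE.
by rewrite eq_sym oner_eq0.
Qed.

Lemma surface_scale_eq1 a x : 0 < a -> S x -> S (a *: x) -> a = 1.
Proof.
move=> a0 Sx Sax; have [[_ inj _] _ _] := surface_homeo.
have : a *: x = x.
  apply: inj; rewrite ?inE// /radial.
  under eq_bigr do rewrite mxE.
  by rewrite -mulr_sumr invfM scalerA mulrAC mulVf ?mul1r// gt_eqF.
move=> /(congr1 (fun y => y - x)); rewrite subrr -{2}(scale1r x) -scalerBl.
by move=> /eqP; rewrite scaler_eq0 subr_eq0 (negPf (surface_neq0 Sx)) orbF => /eqP.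
Qed.

Lemma surface_param : exists h : 'rV[R]_3 -> 'rV[R]_3,
  (forall y, simplex R y -> S (h y) /\ radial (h y) = y) /\
  (forall y, simplex R y -> forall e : R, 0 < e -> exists2 d : R, 0 < d &
     forall z, simplex R z -> `|z - y| < d -> `|h z - h y| < e).
Proof.
have [[_ _ sur] _ [h [ch hK]]] := surface_homeo; exists h; split=> [y /sur[x Sx <-]|].
  by rewrite hK.
move=> y sy e e0; move/subspace_continuousP: ch => /(_ y sy) /cvgrPdist_lt /(_ _ e0).
rewrite near_withinE => /nbhs_ballP[d /= d0 hd]; exists d => // z sz zd.
by rewrite distrC; apply: hd => //; rewrite -ball_normE /= distrC.
Qed.

Lemma surface_on_ray z : orthant R z -> z != 0 -> exists2 t, 0 < t & S (t *: z).
Proof.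
move=> z0 zn0; have [s0 sz zE] := simplex_radial z0 zn0.
have [h [/(_ _ sz)[Sh hE] _]] := surface_param.
have [t0 _ hE'] := simplex_radial (surface_orthant Sh) (surface_neq0 Sh).
exists ((\sum_i h (radial z) 0 i) * (\sum_i z 0 i)^-1); first by rewrite mulr_gt0 ?invr_gt0.
by rewrite -scalerA -zE -[X in _ *: X]hE hE' scalerA mulfV ?gt_eqF// scale1r.
Qed.

Lemma hull_surface x : S x -> hull x.
Proof. by move=> Sx; exists 1, x; rewrite ler01 lexx scale1r. Qed.

Lemma hull_orthant z : hull z -> orthant R z.
Proof.
by move=> [a [x [/andP[a0 _] /surface_orthant x0 ->]]] i; rewrite mxE mulr_ge0.
Qed.

Lemma hull_segment y z t : 0 <= t <= 1 -> hull y -> hull z ->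
  hull (y + t *: (z - y)).
Proof.
move=> /andP[t0 t1] hy hz.
have := @hconv z y (@Itv01 R t t0 t1).
rewrite !inE => /(_ hz hy); congr hull.
transitivity (t *: z + (1 - t) *: y); first by [].
by rewrite scalerBl scale1r scalerBr addrCA.
Qed.

Lemma int_orthant_neq0 x : int_orthant R x -> x != 0.
Proof. by move=> x0; apply/rV0Pn; exists 0; rewrite gt_eqF. Qed.

(** If [y] were outside the hull, the point of [S] on its ray would be [t *: y] with [t < 1], hence
    below the point [s] of [S] in every coordinate; unorderedness of interior points forbids
    this. *)
Lemma hull_below x y : hull x -> int_orthant R x -> int_orthant R y ->
  (forall i, y 0 i <= x 0 i) -> hull y.
Proof.
move=> [a [s [/andP[a0 a1] Ss xE]]] x0 y0 yx.
have s0 : int_orthant R s.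
  move=> i; have := x0 i; rewrite xE mxE => /lt_le_trans.
  have : a * s 0 i <= s 0 i by rewrite ler_piMl// surface_orthant.
  by move=> asi; apply.
have [t t0 Sty] := surface_on_ray (fun i => ltW (y0 i)) (int_orthant_neq0 y0).
have [t1|t1] := leP 1 t.
  exists t^-1, (t *: y); rewrite invr_ge0 ltW//= invf_le1// scalerA.
  by rewrite mulVf ?scale1r// gt_eqF.
have lt i : (t *: y) 0 i < s 0 i.
  rewrite mxE; apply: (@lt_le_trans _ _ (y 0 i)); first by rewrite gtr_pMl.
  by apply: le_trans (yx i) _; rewrite xE mxE ler_piMl// surface_orthant.
case: (@surface_unordered (t *: y) s) => //.
  by split=> // i; rewrite mxE mulr_gt0.
by split=> [i _|E]; [exact/ltW/lt|have := lt 0; rewrite E ltxx].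
Qed.

(** Halving one coordinate of [x] stays in the hull by [hull_below], and would increase [dot p] if
    that entry of [p] were negative. *)
Lemma normal_ge0 p x : hull x -> int_orthant R x -> normal p x ->
  forall i, 0 <= p 0 i.
Proof.
move=> hx x0 nx i; rewrite leNgt; apply/negP => pi.
have hxi : 0 < x 0 i / 2 by rewrite divr_gt0.
have : hull (x - (x 0 i / 2) *: delta_mx 0 i).
  apply: (hull_below hx x0) => j; rewrite !mxE eqxx /=.
    by have [->|_] := eqVneq j i; rewrite ?mulr1 ?mulr0 ?subr0//; lra.
  by rewrite lerBlDr lerDl mulr_ge0// ltW.
by move=> /nx; rewrite dotBr dotZr dot_delta; nra.
Qed.

Lemma axis_hull i : exists2 t, 0 < t & hull (t *: delta_mx 0 i).
Proof.
have [j||t t0 St] := @surface_on_ray (delta_mx 0 i); last first.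
- by exists t => //; exact: hull_surface.
- by apply/rV0Pn; exists i; rewrite mxE !eqxx oner_eq0.
- by rewrite mxE ler0n.
Qed.

Lemma normal_gt0 p x : (forall i, 0 <= p 0 i) -> p != 0 -> normal p x ->
  0 < dot p x.
Proof.
move=> p0 /rV0Pn[i pi] nx; have [t t0 /nx] := axis_hull i.
apply: lt_le_trans; rewrite dotZr dot_delta mulr_gt0//.
by rewrite lt_neqAle eq_sym pi p0.
Qed.

Lemma normal_surface p x : hull x -> (forall i, 0 <= p 0 i) -> p != 0 ->
  normal p x -> S x.
Proof.
move=> [a [s [/andP[a0 a1] Ss xE]]] p0 pn0 nx.
have := normal_gt0 p0 pn0 nx; have := nx _ (hull_surface Ss).
rewrite xE dotZr => pas asp.
have ps : 0 < dot p s by nra.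
have : 1 <= a by rewrite -(ler_pM2r ps) mul1r.
by move=> a1'; rewrite (_ : a = 1) ?scale1r//; apply/eqP; rewrite eq_le a1.
Qed.

(** Projection onto a compact convex set: [y] is the point of the hull nearest to [z], and the
    residual supports the hull there. *)
Lemma nearest_normal z : ~ hull z -> exists y,
  [/\ hull y, z - y != 0, normal (z - y) y &
      forall w, hull w -> dot (z - y) (z - y) <= dot (z - w) (z - w)].
Proof.
move=> hz.
have [||y] := @compact_EVT_min _ _ (fun y => dot (z - y) (z - y)) hull _ hull_compact.
- by have [t _ ht] := axis_hull 0; exists (t *: delta_mx 0 0).
- apply: continuous_subspaceT => y.
  have zy : z - w @[w --> y] --> z - y by apply: (cvgB (F := nbhs y)); [exact: cvg_cst|exact: cvg_id].
  exact: (cvg_dot (F := nbhs y) _ zy zy).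
rewrite inE => hy ymin; exists y.
have {}ymin w : hull w -> dot (z - y) (z - y) <= dot (z - w) (z - w).
  by move=> hw; apply: ymin; rewrite inE.
split=> //; first by rewrite subr_eq0; apply/eqP => zy; apply: hz; rewrite zy.
move=> w hw; rewrite leNgt; apply/negP; rewrite -subr_gt0 -dotBr.
set n := z - y; set v := w - y; set c := dot n v => c0; set d := dot v v.
have d0 : 0 <= d by apply: sumr_ge0 => i _; exact: sqr_ge0.
have cd : 0 < c + d by rewrite ltr_pwDl.
(* Going from [y] to [y + t *: v] with [t = c / (c + d)] changes the squared distance by
   [- 2 t c + t^2 d = - t c - t^2 c < 0]. *)
have t01 : 0 <= c / (c + d) <= 1.
  by rewrite divr_ge0 ?(ltW c0) ?(ltW cd)//= ler_pdivrMr// mul1r lerDl.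
have := ymin _ (hull_segment t01 hy hw).
set t := c / (c + d); have tE : t * (c + d) = c by rewrite divfK ?gt_eqF.
rewrite opprD addrA -/n -/v (dotBr _ n) !(dotBl _ n) !dotZl !dotZr (dotC v) -/c -/d.
have t0 : 0 < t by rewrite divr_gt0.
nra.
Qed.

(** The radial image of [x] is moved slightly towards the barycentre of the simplex and lifted back
    to [S] by the continuous inverse of the projection. *)
Lemma surface_interior_dense x : S x -> forall e : R, 0 < e ->
  exists y, [/\ S y, int_orthant R y & `|y - x| < e].
Proof.
move=> Sx e e0; have [h [Sh hc]] := surface_param.
have [s0 sx xE] := simplex_radial (surface_orthant Sx) (surface_neq0 Sx).
have hx : h (radial x) = x.
  by have [[_ inj _] _ _] := surface_homeo; have [? ?] := Sh _ sx; apply: inj; rewrite ?inE.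
have [d d0 hd] := hc _ sx _ e0; rewrite hx in hd.
pose b : 'rV[R]_3 := const_mx 3^-1; set m := `|b - radial x|.
have m_ge0 : 0 <= m := normr_ge0 _.
have m0 : 0 < m + 1 by rewrite ltr_wpDl.
(* The bound 1 makes [y] a convex combination; the other bound gives [s * m < d]. *)
pose s := Num.min 1 (d / (m + 1) / 2).
have s_gt0 : 0 < s by rewrite lt_min ltr01 !divr_gt0.
have s_le1 : s <= 1 by rewrite ge_min lexx.
pose y := radial x + s *: (b - radial x).
have y0 : int_orthant R y.
  move=> i; rewrite !mxE; have := sx.1 i; rewrite mxE.
  set r := _ * x 0 i => r0; have -> : r + s * (3^-1 - r) = (1 - s) * r + s * 3^-1 by ring.
  apply: ltr_wpDl; first by rewrite mulr_ge0// subr_ge0.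
  by rewrite mulr_gt0// invr_gt0.
have sy : simplex R y.
  split=> [i|]; first exact/ltW/y0.
  rewrite /plane /=.
  rewrite (eq_bigr (fun i => (1 - s) * radial x 0 i + s * 3^-1)); last first.
    by move=> i _; rewrite !mxE; ring.
  rewrite big_split -mulr_sumr /= [\sum_i radial x 0 i]sx.2.
  by rewrite sumr_const card_ord -mulr_natl; lra.
have [Shy hyE] := Sh _ sy; exists (h y); split=> //; last first.
  apply: hd => //; rewrite addrC addKr normrZ gtr0_norm//.
  apply: (@le_lt_trans _ _ (d / (m + 1) / 2 * m)).
    by rewrite ler_wpM2r// ge_min lexx orbT.
  have : 0 < d / (m + 1) by rewrite divr_gt0.
  have : d / (m + 1) * (m + 1) = d by rewrite divfK ?gt_eqF.
  nra.
have [t0 _ hE] := simplex_radial (surface_orthant Shy) (surface_neq0 Shy).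
move=> i; have := y0 i; rewrite -[in X in X -> _]hyE hE mxE.
by rewrite pmulr_rgt0 ?invr_gt0.
Qed.

Definition normal_graph : set ('rV[R]_3 * 'rV[R]_3) :=
  [set q | [/\ S q.1, int_orthant R q.1, dot q.2 q.1 = 1 & normal q.2 q.1]].

Lemma normal_graphI x p : S x -> int_orthant R x -> p != 0 -> normal p x ->
  0 < dot p x /\ normal_graph (x, (dot p x)^-1 *: p).
Proof.
move=> Sx x0 pn0 nx.
have px := normal_gt0 (normal_ge0 (hull_surface Sx) x0 nx) pn0 nx.
split=> //; split=> //=; first by rewrite dotZl mulVf// gt_eqF.
by move=> y /nx; rewrite !dotZl ler_pM2l// invr_gt0.
Qed.

(** After a move to an interior point [x1], the point [(1 + s) *: x1] just outside the hull is
    projected back. The foot is close to [x1], hence still interior, and the residual is a normal at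
    it. *)
Lemma normal_graph_dense x : S x -> forall e : R, 0 < e ->
  exists y p, normal_graph (y, p) /\ `|y - x| < e.
Proof.
move=> Sx e e0.
have e2 : 0 < e / 2 by rewrite divr_gt0.
have [x1 [Sx1 x10 x1x]] := surface_interior_dense Sx e2.
suff [y [p [yp yx1]]] : exists y p, normal_graph (y, p) /\ `|y - x1| < e / 2.
  exists y, p; split=> //; rewrite -(subrKA x1).
  by rewrite (le_lt_trans (ler_normD _ _))// (splitr e) ltrD.
have [r r0 rx1] : exists2 r, 0 < r & forall y, `|y - x1| < r -> int_orthant R y.
  have [i _ imin] := @arg_minP _ _ _ (0 : 'I_3) xpredT (fun i => x1 0 i) isT.
  exists (x1 0 i) => // y yr j; have := le_lt_trans (coord_norm_le _ j) yr.
  by have := imin j isT; rewrite !mxE ltr_norml => ? /andP[? _]; lra.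
set m := `|x1|; have m0 : 0 <= m := normr_ge0 _.
pose d := Num.min (e / 2) r; have d0 : 0 < d by rewrite lt_min e2.
(* The foot will be within [s m + 2 s m] of [x1], so [3 s m < d] is what is wanted. *)
pose s := d / (3 * m + 1).
have s0 : 0 < s by rewrite divr_gt0// ltr_wpDl// mulr_ge0.
have sm : s * (3 * m) < d.
  have : s * (3 * m + 1) = d by rewrite divfK// gt_eqF// ltr_wpDl// mulr_ge0.
  nra.
pose z := (1 + s) *: x1.
have hz : ~ hull z.
  move=> [a [w [/andP[a0 a1] Sw]]]; rewrite /z => zE.
  have an0 : 0 < a.
    rewrite lt_neqAle a0 andbT eq_sym; apply/eqP => aE; move/eqP: zE.
    rewrite aE scale0r scaler_eq0 (negPf (surface_neq0 Sx1)) orbF; lra.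
  have wE : w = (a^-1 * (1 + s)) *: x1.
    by rewrite -scalerA zE scalerA mulVf ?scale1r// gt_eqF.
  have := @surface_scale_eq1 (a^-1 * (1 + s)) x1; rewrite -wE => /(_ _ Sx1 Sw).
  rewrite mulr_gt0 ?invr_gt0 ?addr_gt0// => /(_ isT) /(congr1 ( *%R a)).
  by rewrite mulrA mulfV ?gt_eqF// mul1r mulr1; lra.
have [y [hy n0 ny ymin]] := nearest_normal hz.
have zx1 : z - x1 = s *: x1 by rewrite /z scalerDl scale1r addrC addKr.
(* The max norm is at most the Euclidean one, and the latter is at most [sqrt 3 * s * m] at
   [z - x1]; the constant 2 bounds [sqrt 3]. *)
have zy : `|z - y| <= 2 * s * m.
  have sm0 : 0 <= 2 * s * m by have := ltW s0; nra.
  apply: row_norm_le => // i.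
  have zyi : (z - y) 0 i ^+ 2 <= dot (z - y) (z - y).
    rewrite /dot (bigD1 i) //= -expr2 lerDl; apply: sumr_ge0 => j _.
    exact: sqr_ge0.
  have := le_trans zyi (ymin _ (hull_surface Sx1)).
  rewrite zx1 dotZl dotZr => zyi'.
  have dxx : dot x1 x1 <= 3 * m * m by exact: le_trans (ler_norm _) (norm_dot_le _ _).
  rewrite -(ler_pXn2r (n := 2))// ?nnegrE//.
  rewrite real_normK ?num_real//; apply: le_trans zyi' _.
  rewrite mulrA -expr2; have := ler_wpM2l (sqr_ge0 s) dxx; nra.
have yx1 : `|y - x1| < d.
  have -> : y - x1 = (z - x1) - (z - y) by apply/rowP => i; rewrite !mxE; ring.
  apply: le_lt_trans (ler_normB _ _) _; rewrite zx1 normrZ gtr0_norm// -/m.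
  by apply: le_lt_trans sm; nra.
have [yx1e yx1r] : `|y - x1| < e / 2 /\ `|y - x1| < r.
  by move: yx1; rewrite lt_min => /andP.
have y0 := rx1 _ yx1r.
have Sy := normal_surface hy (normal_ge0 hy y0 ny) n0 ny.
exists y, ((dot (z - y) y)^-1 *: (z - y)); split=> //.
by have [] := normal_graphI Sy y0 n0 ny.
Qed.

Definition limit_normals := closure normal_graph.

Lemma limit_normalsP x p : limit_normals (x, p) ->
  [/\ S x, forall i, 0 <= p 0 i, dot p x = 1 & normal p x].
Proof.
move=> xp.
have c1 : {for (x, p), continuous (@fst 'rV[R]_3 'rV[R]_3)} by exact: cvg_fst.
have c2 : {for (x, p), continuous (@snd 'rV[R]_3 'rV[R]_3)} by exact: cvg_snd.
have px : dot p x = 1.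
  by apply: (closure_closed_image xp (cvg_dot _ c2 c1) (@closed_eq _ 1)) => q [].
split=> //.
- apply: (closure_closed_image xp c1); last by move=> q [].
  by apply: compact_closed surface_compact; exact: norm_hausdorff.
- move=> i.
  apply: (closure_closed_image xp (cvg_coord (i := i) _ c2) (@closed_ge _ 0)) => q.
  by move=> [Sq q0 _ nq]; exact: normal_ge0 (hull_surface Sq) q0 nq i.
- move=> y hy; rewrite px.
  apply: (closure_closed_image xp (cvg_dot _ c2 (cvg_cst y)) (@closed_le _ 1)) => q.
  by move=> [_ _ <-]; apply.
Qed.

(** The hull contains a point [t_i e_i] on each axis, so [dot p x = 1] being maximal bounds the
    entry [p_i] by [1 / t_i]. *)
Lemma limit_normals_compact : compact limit_normals.
Proof.
have /choice[t tP] : forall i : 'I_3, exists t, 0 < t /\ hull (t *: delta_mx 0 i).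
  by move=> i; have [t t0 ht] := axis_hull i; exists t.
pose M := \sum_i (t i)^-1.
pose B : set 'rV[R]_3 := [set p | `|p| <= M].
have cB : compact B.
  apply: bounded_closed_compact.
    by exists M; split=> [|N MN p /le_trans]; [exact: num_real|apply; exact: ltW].
  apply: (@closed_comp _ _ (fun p : 'rV[R]_3 => `|p|) [set r | r <= M]).
    by move=> p _; exact: norm_continuous.
  exact: closed_le.
apply: subclosed_compact (compact_setX surface_compact cB) _; first exact: closed_closure.
move=> [x p] /limit_normalsP[Sx p0 px nx]; split=> //=.
have t0 i : 0 < (t i)^-1 by rewrite invr_gt0; have [] := tP i.
apply: row_norm_le => [|i]; first by apply: sumr_ge0 => i _; exact/ltW.
apply: (@le_trans _ _ (t i)^-1); last first.
  by rewrite /M (bigD1 i) //= lerDl; apply: sumr_ge0 => j _; exact/ltW.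
have [ti hti] := tP i; have := nx _ hti.
by rewrite px dotZr dot_delta ger0_norm// -ler_pdivlMl// mulr1.
Qed.

(** The base points of limit normals form a compact set, and they are dense in [S] by
    [normal_graph_dense]. *)
Lemma limit_normals_ex x : S x -> exists p, limit_normals (x, p).
Proof.
move=> Sx.
have cS : closed (fst @` limit_normals).
  apply: compact_closed; first exact: norm_hausdorff.
  apply: continuous_compact limit_normals_compact.
  by apply: continuous_subspaceT => q; exact: cvg_fst.
have [|[y p] yp /= <-] := cS x; last by exists p.
move=> V /nbhs_ballP[e /= e0 eV].
have [y [p [yp yx]]] := normal_graph_dense Sx e0.
exists y; split; first by exists (y, p) => //; exact: subset_closure.
by apply: eV; rewrite -ball_normE /= distrC.
Qed.

End ConvexSurface.

(** * Pullback of covectors, and signs of the inverse derivative *)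

Section Derivatives.
Variable R : realType.
Implicit Types (f g : 'rV[R]_3 -> 'rV[R]_3) (x v p : 'rV[R]_3).

Lemma DE f x i j : differentiable f x -> D f x i j = 'D_(delta_mx 0 j) f x 0 i.
Proof. by move=> fx; rewrite deriveEjacobian// -rowE !mxE. Qed.

(** At points of differentiability this is [p *m D f x]. Directional derivatives are used because
    their continuity in [x] is what [Ck_on] gives directly. *)
Definition pull_covector f x p : 'rV[R]_3 :=
  \row_j dot p ('D_(delta_mx 0 j) f x).

Lemma pull_covectorE f x p : differentiable f x ->
  pull_covector f x p = p *m D f x.
Proof.
by move=> fx; apply/rowP => j; rewrite !mxE; apply: eq_bigr => i _; rewrite DE.
Qed.

Lemma dot_pull_covector f x p v : differentiable f x ->
  dot (pull_covector f x p) v = dot p ('D_v f x).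
Proof.
move=> fx; rewrite pull_covectorE// deriveEjacobian// /D.
transitivity ((p *m ('J f x)^T *m v^T) 0 0).
  by rewrite mxE; apply: eq_bigr => i _; rewrite [v^T _ _]mxE.
rewrite -mulmxA -trmx_mul mxE; apply: eq_bigr => i _.
by rewrite [(_ *m _)^T _ _]mxE.
Qed.

Lemma D_left_inverse f g (U : set 'rV[R]_3) x : open U -> U x ->
  (forall y, U y -> g (f y) = y) -> differentiable f x ->
  differentiable g (f x) -> D g (f x) *m D f x = 1%:M.
Proof.
move=> oU Ux gK fx gx; rewrite /D -trmx_mul -trmx1; congr trmx.
apply/row_matrixP => i; rewrite !rowE mulmxA -!deriveEjacobian//.
rewrite !deriveE// -[LHS]/(('d g (f x) \o 'd f x) _) -diff_comp//.
rewrite mulmx1 -deriveE; last exact: differentiable_comp.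
rewrite (near_eq_derive (g := id)) ?derive_id//.
by apply: filterS (open_nbhs_nbhs (conj oU Ux)) => y /gK.
Qed.
End Derivatives.

Lemma orthant_closure (R : realType) : orthant R `<=` closure (int_orthant R).
Proof.
move=> x x0 V /nbhs_ballP[e /= e0 eV]; exists (x + const_mx (e / 2)); split.
  by move=> i; rewrite !mxE ltr_wpDl// divr_gt0.
apply: eV; rewrite -ball_normE /= opprD addrA subrr sub0r normrN.
apply: row_norm_lt => // i; rewrite mxE gtr0_norm ?divr_gt0//.
by rewrite ltr_pdivrMr// ltr_pMr// ltr1n.
Qed.

Lemma int_faceT (R : realType) (x : 'rV[R]_3) :
  int_face R [set: 'I_3]%SET x <-> int_orthant R x.
Proof.
split=> [[_ x0] i|x0]; first exact/x0/finset.in_setT.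
by split=> //; split=> [i|i]; [exact/ltW|rewrite finset.in_setT].
Qed.

Definition coord_support (R : realType) (x : 'rV[R]_3) : {set 'I_3} :=
  [set i | x 0 i != 0]%SET.

Lemma int_face_support (R : realType) (x : 'rV[R]_3) : orthant R x ->
  int_face R (coord_support x) x.
Proof.
move=> x0; split=> [|i]; last by rewrite finset.inE lt_neqAle eq_sym => ->; exact: x0.
by split=> // j; rewrite finset.inE negbK => /eqP.
Qed.

(** The second clause is [H3'] applied to the basis vector [e_j], whose image under the inverse
    derivative is column [j]. *)
Lemma H3'_entries (R : realType) (Pt : 'rV[R]_3 -> 'rV[R]_3) (hH3' : H3' Pt)
    (I : {set 'I_3}) x :
  I != finset.set0 -> int_face R I x ->
  (forall i j, i \in I -> j \in I -> 0 < invmx (D Pt x) i j) /\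
  (forall j, j \notin I -> exists2 i, i \in I & 0 < invmx (D Pt x) i j).
Proof.
move=> I0 xI; have [pos out] := hH3' _ I0 _ xI; split=> [i j iI jI|j jI].
  have := pos (enum_rank_in iI i) (enum_rank_in iI j).
  by rewrite mxE !enum_rankK_in.
have [||i iI Aij] := out (delta_mx 0 j); last 1 first.
- by exists i => //; move: Aij; rewrite trmx_delta -colE mxE.
- split=> [i|i]; first by rewrite mxE ler0n.
  rewrite finset.in_setC negbK mxE eqxx /= => iI.
  by have [ij|//] := eqVneq i j; rewrite -ij iI in jI.
- by move=> /matrixP/(_ 0 j)/eqP; rewrite !mxE !eqxx oner_eq0.
Qed.

Section Competitive.
Variables (R : realType) (P Pt : 'rV[R]_3 -> 'rV[R]_3) (U : set 'rV[R]_3).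
Hypotheses (hH1 : H1 P Pt U) (hH3' : H3' Pt).
Implicit Types (x y v p : 'rV[R]_3).

(** Nonnegativity of the inverse derivative on the closed orthant is a limit from the open orthant,
    where [H3'] for the full index set makes all entries positive. *)
Lemma extension_inverse : exists G : 'rV[R]_3 -> 'rV[R]_3,
  [/\ forall x, orthant R x -> {for P x, continuous G} /\ G (P x) = x,
      forall x, orthant R x -> differentiable Pt x,
      forall x v, orthant R x -> {for x, continuous (fun y => 'D_v Pt y)},
      forall x, orthant R x -> D Pt x \in unitmx &
      forall x i j, orthant R x -> 0 <= invmx (D Pt x) i j].
Proof.
have [CU [oU oPU [dP cP] [G [[dG cG] GK]]] PtP] := hH1.
have DK x : U x -> D G (Pt x) *m D Pt x = 1%:M.
  move=> Ux; apply: (D_left_inverse oU Ux GK (dP _ Ux)).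
  by apply: dG; exists x.
have uD x : U x -> D Pt x \in unitmx by move=> /DK /mulmx1_unit[].
have invE x : U x -> invmx (D Pt x) = D G (Pt x).
  by move=> Ux; rewrite -[LHS]mul1mx -(DK _ Ux) mulmxK// uD.
exists G; split=> [x Cx|x /CU /dP//|x v /CU Ux|x /CU /uD//|x i j Cx].
- have Ux := CU _ Cx; rewrite -(PtP _ Cx); split; last exact: GK.
  by apply/differentiable_continuous/dG; exists x.
- by have [/(_ _ Ux)/differentiable_continuous] := cP v.
- have Ux := CU _ Cx; rewrite invE// DE; last by apply: dG; exists x.
  pose phi y := 'D_(delta_mx 0 j) G (Pt y) 0 i.
  have cphi : {for x, continuous phi}.
    have cPt := differentiable_continuous (dP _ Ux).
    have cDG : {for Pt x, continuous (fun y => 'D_(delta_mx 0 j) G y)}.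
      have [dDG _] := cG (delta_mx 0 j).
      by apply/differentiable_continuous/dDG; exists x.
    exact: (cvg_coord (i := i) _ (continuous_comp cPt cDG)).
  apply: (closure_closed_image (orthant_closure Cx) cphi (@closed_ge _ 0)) => y y0.
  have Uy : U y by apply: CU => k; exact/ltW/y0.
  rewrite /phi -DE; last by apply: dG; exists y.
  rewrite -invE//.
  have T0 : [set: 'I_3]%SET != finset.set0.
    by apply/finset.set0Pn; exists 0; exact: finset.in_setT.
  have [+ _] := H3'_entries hH3' T0 (iffRL (int_faceT y) y0).
  by move=> pos; apply/ltW/pos; rewrite finset.in_setT.
Qed.

End Competitive.

Lemma dot_derive_le0 (R : realType) (f : 'rV[R]_3 -> 'rV[R]_3)
    (x v p : 'rV[R]_3) :
  differentiable f x ->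
  (forall h : R, 0 < h <= 1 -> dot p (f (h *: v + x)) <= dot p (f x)) ->
  dot p ('D_v f x) <= 0.
Proof.
move=> /(@diff_derivable _ _ _ _ _ v) dfv fle.
have pq := @cvg_dot R 3 _ 0^' (cst p) _ p _ _ (cvg_cst p) dfv.
rewrite leNgt; apply/negP => p0.
have F0 : Filter (0 : R)^' by exact: dnbhs_filter.
have := @cvgr_gt _ _ _ F0 _ _ (pq F0 F0) _ p0; rewrite near_withinE => /nbhs_ballP[r /= r0 rp].
pose h := Num.min (r / 2) 1.
have h0 : 0 < h by rewrite lt_min divr_gt0//= ltr01.
have hr : h < r.
  rewrite /h gt_min; apply/orP; left; rewrite ltr_pdivrMr// ltr_pMr//.
  by rewrite ltr1n.
have : 0 < dot p (h^-1 *: ((f \o shift x) (h *: v) - f x)).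
  apply: rp; first by rewrite /ball /= sub0r normrN gtr0_norm.
  by rewrite gt_eqF.
rewrite dotZr pmulr_rgt0 ?invr_gt0// dotBr subr_gt0 ltNge fle//.
by rewrite h0 /h ge_min lexx orbT.
Qed.

(** * Invariance of the limit normals under pullback by the derivative *)

Section Pullback.
Variables (R : realType) (P Pt : 'rV[R]_3 -> 'rV[R]_3) (U S : set 'rV[R]_3).
Hypotheses (hH1 : H1 P Pt U) (hH2 : H2 P) (hH3' : H3' Pt).
Hypotheses (hS : carrying_simplex P S) (hconv : convex_carrying_simplex S).
Implicit Types (x y v p q : 'rV[R]_3).

Lemma preimage_int_face (I : {set 'I_3}) x : I != finset.set0 -> orthant R x ->
  int_face R I (P x) -> int_face R I x.
Proof.
move=> I0 x0 PxI.
by have [_] := hH2 I0 (or_intror (or_introl (erefl (int_face R I)))); apply.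
Qed.

(** [P] maps the segment from [x] to [y] into the hull, so [dot p] composed with [P] is largest at
    its start and has a nonpositive derivative there. *)
Lemma pull_normal x p : S x -> normal S p (P x) -> normal S (pull_covector Pt x p) x.
Proof.
move=> Sx nPx y hy.
have [G [_ dPt _ _ _]] := extension_inverse hH1 hH3'.
have [_ _ PtP] := hH1; have Cx := surface_orthant hS Sx.
rewrite -subr_le0 -dotBr dot_pull_covector; last exact: dPt.
apply: dot_derive_le0; first exact: dPt.
move=> h /andP[h0 h1].
have hxy : cone_hull S (h *: (y - x) + x).
  rewrite addrC; apply: (hull_segment hconv) hy; first by rewrite ltW.
  exact: hull_surface.
rewrite !PtP//; last exact: hull_orthant hS _ hxy.
by apply: nPx; have [_ _ _ _ [_ <- _]] := hS; exists (h *: (y - x) + x).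
Qed.

Lemma surface_preimage x : S x -> exists2 y, S y & P y = x.
Proof. by case: hS => -[_ _ PS] _ _ _ _; rewrite -{1}PS => -[y Sy <-]; exists y. Qed.

(** Normalized pullback along the inverse [G] maps [normal_graph] into itself and is continuous at
    [(x, p)], hence sends [(x, p)] into the closure. *)
Lemma limit_normals_pull x p : limit_normals S (x, p) ->
  exists y q s, [/\ limit_normals S (y, q), P y = x, 0 < s &
    p = s *: (q *m invmx (D Pt y))].
Proof.
move=> xp; have [Sx p0 px nx] := limit_normalsP hS xp.
have [y Sy Pyx] := surface_preimage Sx.
have [G [GP dPt cDPt uD _]] := extension_inverse hH1 hH3'.
have Cy := surface_orthant hS Sy; have Dy := dPt _ Cy.
have [cG GPy] := GP _ Cy; rewrite Pyx in cG GPy.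
pose phi (w : 'rV[R]_3 * 'rV[R]_3) := pull_covector Pt (G w.1) w.2.
have c1 : {for (x, p), continuous (fun w : 'rV[R]_3 * 'rV[R]_3 => w.1)} by exact: cvg_fst.
have c2 : {for (x, p), continuous (fun w : 'rV[R]_3 * 'rV[R]_3 => w.2)} by exact: cvg_snd.
have cG1 : {for (x, p), continuous (fun w : 'rV[R]_3 * 'rV[R]_3 => G w.1)}.
  exact: (continuous_comp c1 cG).
have cphi : {for (x, p), continuous phi}.
  apply: cvg_row => j; rewrite [X in _ --> X]mxE.
  under eq_cvg do rewrite mxE.
  apply: (cvg_dot _ c2).
  have cD : {for G x, continuous (fun z => 'D_(delta_mx 0 j) Pt z)}.
    by rewrite GPy; exact: cDPt.
  exact: (continuous_comp cG1 cD).
have graph_pull z q : normal_graph S (z, q) ->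
    0 < dot (phi (z, q)) (G z) /\
    normal_graph S (G z, (dot (phi (z, q)) (G z))^-1 *: phi (z, q)).
  move=> [/= Sz z0 qz nz]; have [z' Sz' Pz'] := surface_preimage Sz.
  have Cz' := surface_orthant hS Sz'; have [_ GPz'] := GP _ Cz'.
  rewrite /phi /= -Pz' GPz'; apply: (normal_graphI hS Sz').
  - apply/int_faceT/preimage_int_face => //; last by rewrite Pz'; exact/int_faceT.
    by apply/finset.set0Pn; exists 0; exact: finset.in_setT.
  - rewrite pull_covectorE; last exact: dPt.
    apply: contra_eqN qz => /eqP qD.
    have -> : q = 0 by rewrite -[q](mulmxK (uD _ Cz')) qD mul0mx.
    by rewrite dotC dot0r eq_sym oner_eq0.
  - by apply: pull_normal => //; rewrite Pz'.
have phiE : phi (x, p) = p *m D Pt y by rewrite /phi /= GPy pull_covectorE.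
have phi0 i : 0 <= phi (x, p) 0 i.
  apply: (closure_closed_image xp (cvg_coord (i := i) _ cphi) (@closed_ge _ 0)).
  move=> [z q] /graph_pull[d0 [/= Sz z0 _ nz]].
  have := normal_ge0 hS (hull_surface Sz) z0 nz i.
  by rewrite mxE pmulr_rge0// invr_gt0.
have phin0 : phi (x, p) != 0.
  rewrite phiE; apply: contra_eqN px => /eqP pD.
  have -> : p = 0 by rewrite -[p](mulmxK (uD _ Cy)) pD mul0mx.
  by rewrite dotC dot0r eq_sym oner_eq0.
have nphi : normal S (phi (x, p)) y.
  by rewrite /phi /= GPy; apply: pull_normal => //; rewrite Pyx.
have s0 := normal_gt0 hS phi0 phin0 nphi; set s := dot _ y in s0.
exists y, (s^-1 *: phi (x, p)), s; split=> //; last first.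
  by rewrite -scalemxAl phiE mulmxK ?uD// scalerA mulfV ?scale1r// gt_eqF.
(* The factor [s] had to be positive first, so that the normalization is continuous at [(x, p)]. *)
pose Phi (w : 'rV[R]_3 * 'rV[R]_3) := (G w.1, (dot (phi w) (G w.1))^-1 *: phi w).
have -> : (y, s^-1 *: phi (x, p)) = Phi (x, p) by rewrite /Phi /= GPy.
apply: (closure_closed_image xp _ (@closed_closure _ _)); last first.
  by move=> [z q] /graph_pull[_ ?]; exact: subset_closure.
have cinv : {for (x, p), continuous (fun w => (dot (phi w) (G w.1))^-1)}.
  by apply: cvgV; [rewrite /= GPy gt_eqF|exact: cvg_dot cphi cG1].
exact: (cvg_pair cG1 (cvgZ cinv cphi)).
Qed.
End Pullback.

(** * Cross-ratio contraction and uniqueness of the limit normal *)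

Lemma mulmx_row_gt0 (R : realType) n (p : 'rV[R]_n) (A : 'M[R]_n) i j :
  (forall k, 0 <= p 0 k) -> (forall k, 0 <= A k j) -> 0 < p 0 i -> 0 < A i j ->
  0 < (p *m A) 0 j.
Proof.
move=> p0 A0 pi Aij; rewrite mxE (bigD1 i) //= ltr_wpDr// ?mulr_gt0//.
by apply: sumr_ge0 => k _; rewrite mulr_ge0.
Qed.

(** Two columns of a nonnegative matrix with a common positive row cannot
    preserve a maximal cross-ratio [p_a q_b / (q_a p_b)]. *)
Lemma cross_ratio_contract (R : realType) n (p q : 'rV[R]_n) (A : 'M[R]_n)
    (H : R) i j l :
  1 < H -> (forall a b, 0 <= A a b) -> 0 < p 0 i -> 0 < q 0 i ->
  (forall a b, p 0 a * q 0 b <= H * (q 0 a * p 0 b)) ->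
  0 < A i j -> 0 < A i l ->
  (p *m A) 0 j * (q *m A) 0 l < H * ((q *m A) 0 j * (p *m A) 0 l).
Proof.
move=> H1 A0 pi qi pq Aij Ail; rewrite -subr_gt0.
(* Every term of this double sum is nonnegative, and the term [a = b = i] is
   [A i j * A i l * (H - 1) * p_i * q_i > 0]. *)
have -> : H * ((q *m A) 0 j * (p *m A) 0 l) - (p *m A) 0 j * (q *m A) 0 l =
    \sum_a \sum_b A a j * A b l * (H * (q 0 a * p 0 b) - p 0 a * q 0 b).
  rewrite !mxE !big_distrlr /= mulr_sumr -sumrB; apply: eq_bigr => a _.
  by rewrite mulr_sumr -sumrB; apply: eq_bigr => b _; ring.
have ge0 a b : 0 <= A a j * A b l * (H * (q 0 a * p 0 b) - p 0 a * q 0 b).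
  by rewrite !mulr_ge0// subr_ge0.
rewrite (bigD1 i) //= ltr_wpDr//.
  by apply: sumr_ge0 => a _; apply: sumr_ge0 => b _.
rewrite (bigD1 i) //= ltr_wpDr//; first by apply: sumr_ge0 => b _.
rewrite !mulr_gt0//.
have := mulr_gt0 pi qi; nra.
Qed.

Section Uniqueness.
Variables (R : realType) (P Pt : 'rV[R]_3 -> 'rV[R]_3) (U S : set 'rV[R]_3).
Hypotheses (hH1 : H1 P Pt U) (hH2 : H2 P) (hH3' : H3' Pt).
Hypotheses (hS : carrying_simplex P S) (hconv : convex_carrying_simplex S).
Implicit Types (x y v p q : 'rV[R]_3).

Lemma support_neq0 x : S x -> coord_support x != finset.set0.
Proof.
move=> /(surface_neq0 hS)/rV0Pn[i xi].
by apply/finset.set0Pn; exists i; rewrite finset.inE.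
Qed.

Lemma inv_deriv_ge0 x i j : S x -> 0 <= invmx (D Pt x) i j.
Proof.
move=> /(surface_orthant hS) Cx.
by have [G [_ _ _ _]] := extension_inverse hH1 hH3'; apply.
Qed.

(** Dimension three enters here: if [j] and [l] are distinct and both outside the support, the
    support has a single element, so the positive rows of the two columns coincide. *)
Lemma inv_deriv_common_row x j l : S x ->
  exists i, 0 < invmx (D Pt x) i j /\ 0 < invmx (D Pt x) i l.
Proof.
move=> Sx; have xI := int_face_support (surface_orthant hS Sx).
have [pos out] := H3'_entries hH3' (support_neq0 Sx) xI.
set I := coord_support x in xI pos out.
have [jI|jI] := boolP (j \in I); have [lI|lI] := boolP (l \in I).
- by exists j; split; exact: pos.
- by have [i iI il] := out _ lI; exists i; split=> //; exact: pos.
- by have [i iI ij] := out _ jI; exists i; split=> //; exact: pos.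
have [<-|jl] := eqVneq j l; first by have [i _ ij] := out _ jI; exists i.
have [i iI ij] := out _ jI; have [k kI kl] := out _ lI.
exists i; split=> //; suff -> : i = k by [].
apply/eqP/negPn/negP => ik.
have u : uniq [:: j; l; i; k].
  have ne a b : a \notin I -> b \in I -> a != b.
    by move=> aI bI; apply: contraNneq aI => ->.
  by rewrite /= !inE !negb_or jl ik !ne.
by have := max_card (mem [:: j; l; i; k]); rewrite (card_uniqP u) card_ord.
Qed.

(** Two pullbacks are used, over points with the same support [I]. From [dot r z = 1], some entry of
    [r] in [I] is positive; the positive [I x I] block spreads this to all entries of [q] in [I];
    each column then has a positive entry in a row of [I], which makes all of [p] positive. *)
Lemma limit_normals_gt0 x p : limit_normals S (x, p) -> forall j, 0 < p 0 j.
Proof.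
move=> xp; have [Sx _ _ _] := limit_normalsP hS xp.
have [y [q [s [yq Pyx s0 ->]]]] := limit_normals_pull hH1 hH2 hH3' hS hconv xp.
have [z [r [t [zr Pzy t0 qE]]]] := limit_normals_pull hH1 hH2 hH3' hS hconv yq.
have [Sy q0 _ _] := limit_normalsP hS yq.
have [Sz r0 rz _] := limit_normalsP hS zr.
pose I := coord_support x; have I0 := support_neq0 Sx.
have xI : int_face R I x := int_face_support (surface_orthant hS Sx).
have yI : int_face R I y.
  by apply: (preimage_int_face hH2) => //; [exact: surface_orthant hS _ Sy|rewrite Pyx].
have zI : int_face R I z.
  by apply: (preimage_int_face hH2) => //; [exact: surface_orthant hS _ Sz|rewrite Pzy].
have [i iI ri] : exists2 i, i \in I & 0 < r 0 i.
  have [i] : exists i, 0 < r 0 i * z 0 i.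
    apply/existsP; apply: contraT; rewrite negb_exists => /forallP rz0.
    have : dot r z <= 0 by apply: sumr_le0 => k _; rewrite leNgt.
    by rewrite rz ler10.
  move=> rzi; exists i.
    by apply: contraTT rzi => /(zI.1.2) ->; rewrite mulr0 ltxx.
  rewrite lt_neqAle r0 andbT eq_sym.
  by apply: contraTneq rzi => ->; rewrite mul0r ltxx.
have qI j : j \in I -> 0 < q 0 j.
  move=> jI; rewrite qE mxE pmulr_rgt0//.
  apply: (mulmx_row_gt0 (i := i)) => // [k|]; first exact: inv_deriv_ge0.
  exact: (H3'_entries hH3' I0 zI).1.
move=> j; rewrite mxE pmulr_rgt0//.
have [pos out] := H3'_entries hH3' I0 yI.
have [k kI Akj] : exists2 k, k \in I & 0 < invmx (D Pt y) k j.
  by have [jI|/out//] := boolP (j \in I); exists j => //; exact: pos.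
apply: (mulmx_row_gt0 (i := k)) => // [l|]; first exact: inv_deriv_ge0.
exact: qI.
Qed.

Lemma limit_normals_unique x p q :
  limit_normals S (x, p) -> limit_normals S (x, q) -> p = q.
Proof.
pose T := ('rV[R]_3 * 'rV[R]_3)%type.
(* Pairs of limit normals over a common point: compactness of this set makes the maximal cross-ratio
   attained. *)
pose K : set (T * T) := (limit_normals S `*` limit_normals S) `&`
  [set w | w.1.1 = w.2.1].
pose cr (jl : 'I_3 * 'I_3) (w : T * T) : R :=
  (w.1.2 0 jl.1 * w.2.2 0 jl.2) / (w.2.2 0 jl.1 * w.1.2 0 jl.2).
have pos (w : T * T) : K w -> (forall j, 0 < w.1.2 0 j) /\ (forall j, 0 < w.2.2 0 j).
  case: w => [[a p1] [b q1]] [[/= w1 w2] _].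
  by split; [exact: limit_normals_gt0 w1|exact: limit_normals_gt0 w2].
have cK : compact K.
  apply: compact_closedI.
    by apply: compact_setX; exact: limit_normals_compact hS.
  have -> : [set w : T * T | w.1.1 = w.2.1] =
      (fun w : T * T => `|w.1.1 - w.2.1|) @^-1` [set t : R | t = 0].
    apply/seteqP; split=> w /=; first by move=> ->; rewrite subrr normr0.
    by move/normr0_eq0/subr0_eq.
  apply: closed_comp; last exact: closed_eq.
  move=> w _; apply: cvg_norm; apply: (cvgB (F := nbhs w)).
    by apply: (@continuous_comp _ _ _ (fun w : T * T => w.1) fst); exact: cvg_fst.
  apply: (@continuous_comp _ _ _ (fun w : T * T => w.2) fst).
    exact: cvg_snd.
  exact: cvg_fst.
move=> xp xq; have Kpq : K ((x, p), (x, q)) by [].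
have crmax jl : exists c, K c /\ forall w, K w -> cr jl w <= cr jl c.
  have [||c cK' cmax] := @compact_EVT_max _ _ (cr jl) K _ cK.
  - by exists ((x, p), (x, q)).
  - apply: continuous_in_subspaceT => w; rewrite inE => /pos[p0 q0].
    have c1 : {for w, continuous (fun w : T * T => w.1.2)}.
      by apply: (@continuous_comp _ _ _ (fun w : T * T => w.1) snd);
        [exact: cvg_fst|exact: cvg_snd].
    have c2 : {for w, continuous (fun w : T * T => w.2.2)}.
      by apply: (@continuous_comp _ _ _ (fun w : T * T => w.2) snd);
        exact: cvg_snd.
    apply: cvgM; first by apply: cvgM; exact: cvg_coord.
    by apply: cvgV; [rewrite gt_eqF// mulr_gt0|apply: cvgM; exact: cvg_coord].
  exists c; split; first by rewrite inE in cK'.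
  by move=> w Kw; apply: cmax; rewrite inE.
have [c /all_and2[cK' cmax]] := choice crmax.
have [jl _ jlmax] := @arg_maxP _ _ _ (ord0, ord0) xpredT (fun jl => cr jl (c jl)) isT.
set H := cr jl (c jl) in jlmax.
have crH w j l : K w -> w.1.2 0 j * w.2.2 0 l <= H * (w.2.2 0 j * w.1.2 0 l).
  move=> Kw; have [p0 q0] := pos _ Kw; rewrite -ler_pdivrMr ?mulr_gt0//.
  exact: le_trans (cmax (j, l) _ Kw) (jlmax (j, l) isT).
(* If [H <= 1], exchanging [j] and [l] turns the bound into its reverse, so [p] and [q] are
   proportional, and the normalization makes them equal. *)
have [H1|H1] := leP H 1.
  have pq w j l : K w -> w.1.2 0 j * w.2.2 0 l <= w.2.2 0 j * w.1.2 0 l.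
    move=> Kw; apply: le_trans (crH _ _ _ Kw) _; have [p0 q0] := pos _ Kw.
    by rewrite ler_piMl// ltW// mulr_gt0.
  have [Sx _ px _] := limit_normalsP hS xp; have [_ _ qx _] := limit_normalsP hS xq.
  apply/rowP => j; rewrite -[LHS]mulr1 -[RHS]mulr1 -{1}qx -px /dot !mulr_sumr.
  apply: eq_bigr => l _; rewrite !mulrA; congr (_ * _).
  apply/eqP; rewrite eq_le (pq _ _ _ Kpq)/=.
  by rewrite mulrC [leRHS]mulrC (pq _ _ _ Kpq).
(* If [H > 1], the maximal pair comes from two normals over one point [y], as [P] is injective; the
   factors [s] and [t] cancel in the cross-ratio. *)
have Kc := cK' jl; have [p0 q0] := pos _ Kc.
case cE : (c jl) Kc p0 q0 => [[a p1] [b q1]] [[/= ap bq] /= ab] p0 q0; subst b.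
have [y [p' [s [yp' Pya s0 p1E]]]] := limit_normals_pull hH1 hH2 hH3' hS hconv ap.
have [y' [q' [t [yq' Pya' t0 q1E]]]] := limit_normals_pull hH1 hH2 hH3' hS hconv bq.
have [Sy _ _ _] := limit_normalsP hS yp'; have [Sy' _ _ _] := limit_normalsP hS yq'.
have yy' : y' = y.
  have [G [GP _ _ _ _]] := extension_inverse hH1 hH3'.
  rewrite -(GP _ (surface_orthant hS Sy)).2 -(GP _ (surface_orthant hS Sy')).2.
  by rewrite Pya Pya'.
subst y'.
have Kp' : K ((y, p'), (y, q')) by [].
have [/= p'0 q'0] := pos _ Kp'.
have [i [Aij Ail]] := inv_deriv_common_row jl.1 jl.2 Sy.
have := cross_ratio_contract H1 (fun a b => inv_deriv_ge0 a b Sy) (p'0 i) (q'0 i)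
  (fun a b => crH _ a b Kp') Aij Ail.
have : H * (q1 0 jl.1 * p1 0 jl.2) = p1 0 jl.1 * q1 0 jl.2.
  by rewrite /H cE /cr /= divfK// gt_eqF// mulr_gt0.
have scE (r : R) (u : 'rV[R]_3) k : (r *: u) 0 k = r * u 0 k by rewrite mxE.
rewrite p1E q1E !scE.
move: ((p' *m _) 0 jl.1) ((q' *m _) 0 jl.2) ((q' *m _) 0 jl.1) ((p' *m _) 0 jl.2).
move=> u1 u2 u3 u4 HE lt; have := mulr_gt0 s0 t0 => st0.
have : s * t * (u1 * u2) < s * t * (H * (u3 * u4)) by rewrite ltr_pM2l.
have -> : s * t * (u1 * u2) = s * u1 * (t * u2) by ring.
by rewrite -HE [ltRHS](_ : _ = H * (t * u3 * (s * u4))) ?ltxx//; ring.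
Qed.
End Uniqueness.

(** * The continuous normal field and the gauge *)

Lemma simplex_partial_orthant (R : realType) (J : {set 'I_3}) :
  simplex R `<=` partial_orthant J.
Proof.
move=> y sy; split=> [j _|]; first exact: sy.1.
apply/existsP; apply: contraT; rewrite negb_exists => /forallP y0.
have : \sum_i y 0 i <= 0 by apply: sumr_le0 => i _; rewrite leNgt.
by have := sy.2; rewrite /plane /= => ->; rewrite ler10.
Qed.

Section NormalField.
Variables (R : realType) (P Pt : 'rV[R]_3 -> 'rV[R]_3) (U S : set 'rV[R]_3).
Hypotheses (hH1 : H1 P Pt U) (hH2 : H2 P) (hH3' : H3' Pt).
Hypotheses (hS : carrying_simplex P S) (hconv : convex_carrying_simplex S).
Implicit Types (x y z v p q : 'rV[R]_3).

(** A single-valued relation with compact graph is continuous. The radius [d] is the distance from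
    [x] to the base points of limit normals at least [e] away from [nu x]; uniqueness makes it
    positive. *)
Lemma normal_field : exists nu : 'rV[R]_3 -> 'rV[R]_3,
  (forall x, S x -> limit_normals S (x, nu x)) /\
  (forall x, S x -> forall e : R, 0 < e -> exists2 d : R, 0 < d &
     forall y, S y -> `|y - x| < d -> `|nu y - nu x| < e).
Proof.
have /choice[nu nuP] x : exists p, S x -> limit_normals S (x, p).
  have [Sx|nSx] := pselect (S x); last by exists 0.
  by have [p xp] := limit_normals_ex hS hconv Sx; exists p.
exists nu; split=> // x Sx e e0.
pose T := ('rV[R]_3 * 'rV[R]_3)%type.
pose K : set T := limit_normals S `&` [set w | e <= `|w.2 - nu x|].
have cK : compact K.
  apply: compact_closedI; first exact: limit_normals_compact hS.
  apply: (@closed_comp _ _ (fun w : T => `|w.2 - nu x|) [set t | e <= t]).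
    move=> w _; apply: cvg_norm; apply: (cvgB (F := nbhs w)); first exact: cvg_snd.
    exact: cvg_cst.
  exact: closed_ge.
have notK y : S y -> ~ K (y, nu y) -> `|nu y - nu x| < e.
  by move=> Sy nK; rewrite ltNge; apply/negP => le; apply: nK; split=> //; exact: nuP.
have [K0|K0] := pselect (K !=set0); last first.
  by exists 1 => // y Sy _; apply: notK => // Ky; apply: K0; exists (y, nu y).
have [|[z p] zpK zmin] := @compact_EVT_min _ _ (fun w : T => `|w.1 - x|) K K0 cK.
  apply: continuous_subspaceT => w; apply: cvg_norm.
  by apply: (cvgB (F := nbhs w)); [exact: cvg_fst|exact: cvg_cst].
rewrite inE in zpK; exists `|z - x|.
  rewrite normr_gt0 subr_eq0; apply/eqP => zx; subst z.
  case: zpK => xp /=.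
  rewrite (limit_normals_unique hH1 hH2 hH3' hS hconv xp (nuP _ Sx)).
  by rewrite subrr normr0 leNgt e0.
move=> y Sy yx; apply: notK => // Ky.
have := zmin (y, nu y); rewrite inE => /(_ Ky) /=.
by rewrite leNgt yx.
Qed.

Lemma radial_continuous x : \sum_i x 0 i != 0 -> {for x, continuous (@radial R)}.
Proof.
move=> x0; apply: (cvgZ (F := nbhs x)); last exact: cvg_id.
apply: (cvgV (F := nbhs x)) => //.
apply: cvg_big => [|i _]; first exact: add_continuous.
exact: coord_continuous.
Qed.

Lemma gauge_C1 : exists (gam : 'rV[R]_3 -> R) g,
  C1_within (partial_orthant [set: 'I_3]%SET) gam g /\
  forall y, simplex R y -> 0 < gam y /\ S ((gam y)^-1 *: y).
Proof.
have [nu [nuP nuc]] := normal_field; have [h [hP hc]] := surface_param hS.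
pose X z := h (radial z); pose g z := nu (X z); pose gam z := dot (g z) z.
pose A := @partial_orthant R 3 [set: 'I_3]%SET.
have AP z : A z -> orthant R z /\ z != 0.
  move=> [z0 [j zj]]; split; last by apply/rV0Pn; exists j; rewrite gt_eqF.
  by move=> i; apply: z0; rewrite finset.in_setT.
have XS z : A z -> S (X z).
  by move=> /AP[z0 zn0]; have [_ sz _] := simplex_radial z0 zn0; have [] := hP _ sz.
have gX z : A z -> dot (g z) (X z) = 1.
  by move=> /XS/nuP/(limit_normalsP hS)[].
have Xray z : A z -> 0 < gam z /\ z = gam z *: X z.
  move=> Az; have [z0 zn0] := AP _ Az; have [s0 sz zE] := simplex_radial z0 zn0.
  have [Sh hE] := hP _ sz.
  have [t0 _ XE] := simplex_radial (surface_orthant hS Sh) (surface_neq0 hS Sh).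
  have : z = ((\sum_i z 0 i) / (\sum_i X z 0 i)) *: X z.
    rewrite -scalerA -XE hE zE scalerA mulfV ?scale1r// gt_eqF//.
  set c := _ / _ => zc; have c0 : 0 < c by rewrite divr_gt0.
  have -> : gam z = c by rewrite /gam {2}zc dotZr gX// mulr1.
  by [].
(* So [g z] is a subgradient of [gam] at [z], because [dot (g z) z] is [gam z] by definition. *)
have gam_ge y z : A y -> A z -> dot (g z) y <= gam y.
  move=> Ay Az; have [y0 {1}->] := Xray _ Ay; rewrite dotZr ler_piMr//; first exact/ltW.
  have [_ _ gz nz] := limit_normalsP hS (nuP _ (XS _ Az)).
  by rewrite /g -gz; apply/nz/hull_surface/XS.
exists gam, g; split.
  (* The division by 3 absorbs the dimension factor in [norm_dot_le]. *)
  move=> x Ax e e0; have e3 : 0 < e / 3 by rewrite divr_gt0.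
  have [d1 d10 H1] := nuc _ (XS _ Ax) _ e3.
  have [x0 xn0] := AP _ Ax; have [s0 sx _] := simplex_radial x0 xn0.
  have [d2 d20 H2] := hc _ sx _ d10.
  have /cvgrPdist_lt/(_ _ d20)/nbhs_ballP[d3 /= d30 H3] :=
    radial_continuous (lt0r_neq0 s0).
  exists d3 => // y Ay yx; have [y0 yn0] := AP _ Ay.
  have [_ sy _] := simplex_radial y0 yn0.
  have gyx : `|g y - g x| < e / 3.
    apply: H1; first exact: XS.
    by apply: H2 => //; rewrite distrC; apply: H3; rewrite -ball_normE /= distrC.
  split; first by rewrite (le_trans (ltW gyx))// ler_pdivrMr// ler_pMr// ler1n.
  (* The subgradient at [x] bounds the remainder from below, the one at [y] from above; continuity
     of [g] closes the gap. *)
  have lo : 0 <= gam y - gam x - dot (g x) (y - x).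
    by rewrite dotBr opprB addrA subrK subr_ge0 gam_ge.
  have up : gam y - gam x - dot (g x) (y - x) <= dot (g y - g x) (y - x).
    by have := gam_ge _ _ Ax Ay; rewrite dotBl !dotBr /gam; lra.
  rewrite ger0_norm//; apply: le_trans up _.
  apply: le_trans (ler_norm _) _; apply: le_trans (norm_dot_le _ _) _.
  by rewrite ler_wpM2r//; lra.
move=> y sy; have Ay : A y by exact: simplex_partial_orthant.
have [y0 yE] := Xray _ Ay; split=> //.
by rewrite {2}yE scalerA mulVf ?scale1r ?gt_eqF//; exact: XS.
Qed.

End NormalField.

(** * The affine chart, the radial parametrization and its transversality *)

Section Chart.
Variable R : realType.

Definition chart_dir : 'M[R]_(2, 2 + 1) := row_mx 1%:M (const_mx (-1)).

Lemma chartB (a b : 'rV[R]_2) : chart a - chart b = (a - b) *m chart_dir.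
Proof.
have E : (1 - \sum_i a 0 i)%:M - (1 - \sum_i b 0 i)%:M =
    (a - b) *m const_mx (-1) :> 'M[R]_1.
  apply/matrixP => i j; rewrite !ord1 !mxE !eqxx !mulr1n opprB addrC addrA subrK.
  rewrite -sumrB; apply: eq_bigr => k _.
  by rewrite !mxE; ring.
transitivity (row_mx (a - b)
    ((1 - \sum_i a 0 i)%:M - (1 - \sum_i b 0 i)%:M) : 'rV[R]_(2 + 1)).
  by rewrite -add_row_mx -opp_row_mx.
by rewrite /chart_dir mul_mx_row mulmx1 E.
Qed.

Lemma cvg_mulmxr n m (M : 'M[R]_(n, m)) : continuous (fun v : 'rV[R]_n => v *m M).
Proof.
move=> v; apply: (cvg_row (F := nbhs v)) => i; rewrite [X in _ --> X]mxE.
under eq_cvg do rewrite mxE.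
apply: (@cvg_big _ _ _ _ _ _ _ (nbhs v)) => [|j _]; first exact: add_continuous.
by apply: (cvgM (F := nbhs v)); [exact: coord_continuous|exact: cvg_cst].
Qed.

Lemma differentiable_chart (a : 'rV[R]_2) : differentiable (@chart R) a /\
  forall v, 'd (@chart R) a v = v *m chart_dir.
Proof.
have [||dc E] := @differentiable_linear R 'rV[R]_2 'rV[R]_3 (@chart R) (mulmxr chart_dir) a.
- exact: cvg_mulmxr.
- move=> e e0; exists 1 => // b _.
  by rewrite chartB subrr normr0 mulr_ge0// ltW.
by split=> // v; rewrite E.
Qed.

End Chart.

Lemma derive_radial (R : realType) (f : 'rV[R]_3 -> R^o) (y v : 'rV[R]_3) :
  differentiable f y ->
  'D_v (fun z => f z *: z) y = 'D_v f y *: y + f y *: v.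
Proof.
move=> fy; have F0 : ProperFilter (0 : R)^' by exact: Proper_dnbhs_numFieldType.
have dfv := @diff_derivable _ _ _ f _ v fy.
have cf : f (h *: v + y) @[h --> (0 : R)^'] --> f y.
  have : {for (0 : R), continuous (fun h : R => f (h *: v + y))}.
    apply: (@continuous_comp _ _ _ (fun h : R => h *: v + y) f).
      apply: (cvgD (F := nbhs (0 : R))); last exact: cvg_cst.
      by apply: (cvgZ (F := nbhs (0 : R))); [exact: cvg_id|exact: cvg_cst].
    by rewrite scale0r add0r; exact: differentiable_continuous.
  by move/continuous_withinNx; rewrite scale0r add0r.
apply: cvg_lim; first exact: norm_hausdorff.
have cD := cvgD (cvgZ dfv (cvg_cst y)) (cvgZ cf (cvg_cst v)).
have F1 : Filter (0 : R)^' by exact: dnbhs_filter.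
apply: (cvg_trans _ (cD F1 F1 F1 F1 F1)); apply: near_eq_cvg.
near=> h; rewrite !fctE /=.
apply/rowP => i; rewrite !mxE.
have h0 : h != 0 by near: h; exact: nbhs_dnbhs_neq.
have quotient (a b c d : R) :
  h^-1 * (a - b) * c + a * d = h^-1 * (a * (h * d + c) - b * c) by field.
exact: quotient.
Unshelve. all: by end_near. Qed.

Section RadialParametrization.
Variables (R : realType) (S : set 'rV[R]_3) (gam : 'rV[R]_3 -> R^o)
  (g : 'rV[R]_3 -> 'rV[R]_3).
Hypotheses (gam_C1 : C1_within (partial_orthant finset.set0) gam g)
  (gam_S : forall y, simplex R y -> 0 < gam y /\ S ((gam y)^-1 *: y)).

(** Positivity of the extended gauge is known only on the simplex, so the domain is cut down to
    where it holds. *)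
Let O : set 'rV[R]_3 := partial_orthant finset.set0 `&` [set y | 0 < gam y].

Let gamP y : O y -> [/\ differentiable gam y, forall v, 'D_v gam y = dot (g y) v &
  {for y, continuous g}].
Proof. by case=> Ay _; apply: C1_within_open gam_C1 => //; exact: open_partial_orthant0. Qed.

Let open_O : open O.
Proof.
rewrite openE => y Oy; have [dg _ _] := gamP Oy; have [Ay y0] := Oy.
apply: filterI.
  by apply: open_nbhs_nbhs; split=> //; exact: open_partial_orthant0.
exact: (cvgr_gt (F := nbhs y) _ (differentiable_continuous dg) _ y0).
Qed.

Let rho y : R^o := (gam y)^-1.

Let rhoP y : O y -> differentiable rho y /\
  forall v, 'D_v rho y = - (gam y) ^- 2 * dot (g y) v.
Proof.
move=> Oy; have [dg Dg _] := gamP Oy; have gn0 : gam y != 0 by rewrite gt_eqF// Oy.2.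
split=> [|v]; first exact: differentiableV.
by rewrite deriveV ?Dg//; exact: diff_derivable.
Qed.

Let simplex_O : simplex R `<=` O.
Proof.
by move=> y sy; split; [exact: simplex_partial_orthant|have [] := gam_S sy].
Qed.

Lemma radial_param_C1 : C1_radial_param S O rho.
Proof.
have DrhoC a v : O (chart a) -> differentiable (rho \o @chart R : _ -> R^o) a /\
    'D_v (rho \o @chart R : _ -> R^o) a =
      - (gam (chart a)) ^- 2 * dot (g (chart a)) (v *m chart_dir R).
  move=> Oa; have [dr Dr] := rhoP Oa; have [dc Dc] := differentiable_chart a.
  have drc : differentiable (rho \o @chart R : _ -> R^o) a.
    exact: differentiable_comp.
  by split=> //; rewrite deriveE// diff_comp//= Dc -deriveE.
have cchart a : {for a, continuous (@chart R)}.
  by have [/differentiable_continuous] := differentiable_chart a.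
split=> //.
- by move=> y [[_ y0] _]; rewrite invr_gt0.
- split=> [a Oa|v a Oa]; first by have [] := DrhoC _ 0 Oa.
  have near_O : \forall b \near a, O (chart b).
    by apply: cchart; apply: open_nbhs_nbhs.
  have [dg _ cg] := gamP Oa.
  have cgam := continuous_comp (cchart a) (differentiable_continuous dg).
  have cgc := continuous_comp (cchart a) cg.
  pose F b := - (gam (chart b)) ^- 2 * dot (g (chart b)) (v *m chart_dir R).
  have cF : {for a, continuous F}.
    apply: (cvgM (F := nbhs a)).
      apply: (cvgN (F := nbhs a)); apply: (cvgV (F := nbhs a)).
        by rewrite expf_neq0// gt_eqF// Oa.2.
      by apply: (cvgM (F := nbhs a)); exact: cgam.
    exact: (cvg_dot (F := nbhs a) _ cgc (cvg_cst _)).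
  rewrite /prop_for /continuous_at (DrhoC _ v Oa).2.
  apply: (cvg_trans _ cF); apply: (near_eq_cvg (F := nbhs a)).
  near=> b; have Ob : O (chart b) by near: b.
  by have [_ ->] := DrhoC _ v Ob.
- move=> y sy; have [y0 Sy] := gam_S sy; split=> //.
  rewrite /radial; under eq_bigr do rewrite mxE.
  rewrite -mulr_sumr; have := sy.2; rewrite /plane /= => ->.
  by rewrite mulr1 scalerA mulVf ?scale1r// invr_neq0// gt_eqF.
Unshelve. all: by end_near. Qed.

Lemma radial_param_neat : S `<=` orthant R -> (forall x, S x -> x != 0) ->
  neatly_embedded S rho.
Proof.
move=> SC Sn0 x I [Sx _] _ [_ xI]; apply/seteqP; split=> // w _.
have [s0 sy yE] := simplex_radial (SC _ Sx) (Sn0 _ Sx).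
set y := radial x in sy yE; have Oy := simplex_O sy; have [dr _] := rhoP Oy.
have r0 : rho y != 0 by rewrite invr_neq0// gt_eqF// Oy.2.
(* Subtracting a multiple of [y] gives [v] coordinate sum 0. The tangent vector along [v] is then
   [w] up to a multiple of [y], and [y] lies in [coordsub R I]. *)
pose v := (rho y)^-1 *: (w - (\sum_i w 0 i) *: y).
have vE : 'D_v (fun z => rho z *: z) y =
    ('D_v rho y - \sum_i w 0 i) *: y + w.
  have vS : rho y *: v = w - (\sum_i w 0 i) *: y.
    by rewrite /v scalerA mulfV ?scale1r.
  by rewrite derive_radial// vS scalerBl addrA addrAC.
exists ('D_v (fun z => rho z *: z) y).
  exists v => //; rewrite /plane_dir /= /v.
  rewrite (eq_bigr (fun i => (rho y)^-1 * (w 0 i - (\sum_j w 0 j) * y 0 i))).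
    rewrite -mulr_sumr sumrB -mulr_sumr; have := sy.2; rewrite /plane /= => ->.
    by rewrite mulr1 subrr mulr0.
  by move=> i _; rewrite !mxE.
exists (- (('D_v rho y - \sum_i w 0 i) *: y)); last by rewrite vE addrAC subrr add0r.
by move=> j jI; rewrite yE !mxE xI.1.2// !mulr0 oppr0.
Qed.

End RadialParametrization.

Theorem theorem3p2 (R : realType) (P Pt : 'rV[R]_3 -> 'rV[R]_3)
    (U S : set 'rV[R]_3)
    (hH1 : H1 P Pt U) (hH2 : H2 P) (hH3' : H3' Pt) (hH4' : H4' P Pt)
    (hH5 : H5 P Pt) (hH6 : H6 P)
    (hS : carrying_simplex P S) (hconv : convex_carrying_simplex S) :
  exists (O : set 'rV[R]_3) (rho : 'rV[R]_3 -> R),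
    C1_radial_param S O rho /\ neatly_embedded S rho.
Proof.
have [gam0 [g0 [/C1_within_partial_orthant[gam [g [gamC1 gamE]]] gamS0]]] :=
  gauge_C1 hH1 hH2 hH3' hS hconv.
have gamS y : simplex R y -> 0 < gam y /\ S ((gam y)^-1 *: y).
  by move=> sy; rewrite gamE; [exact: gamS0|exact: simplex_partial_orthant].
eexists _, _; split; first exact: radial_param_C1 gamC1 gamS.
apply: (radial_param_neat gamC1 gamS); first exact: surface_orthant hS.
exact: surface_neq0 hS.
Qed.
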